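(* Let $N\in\mathbb{N}$, $\lambda\in\mathbb{C}$, $0\le p\le n$. Then, as differential operators $\Omega^p(\mathbb{R}^n)\to\Omega^p(\mathbb{R}^{n-1})$, $$D_{2N}^{BS,(p\to p)}(\lambda)=(-2)^N\Big(\lambda-\frac n2-2N\Big)_N(2N-1)!!\,(\lambda-n+p-2N+1)_{2N-1}(\lambda-p-2N+1)_{2N}\,D^{(p\to p)}_{2N}(n-\lambda),$$ $$D_{2N+1}^{BS,(p\to p)}(\lambda)=(-2)^{N+1}\Big(\lambda-\frac n2-2N-1\Big)_{N+1}(2N+1)!!\,(\lambda-n+p-2N)_{2N}(\lambda-p-2N)_{2N+1}\,D^{(p\to p)}_{2N+1}(n-\lambda).$$
   Context: Let $n\ge2$. $(a)_m=a(a+1)\cdots(a+m-1)$, $(a)_0=1$. $\iota:\mathbb{R}^{n-1}\to\mathbb{R}^n$, $x'\mapsto(x',0)$, and $\iota^*$ is pull-back of differential forms. $i_{e_k},\varepsilon_{e_k}$ are interior and exterior products with the standard basis vector $e_k$; $d=\sum_{k=1}^n\varepsilon_{e_k}\partial_k$, $\delta=-\sum_{k=1}^ni_{e_k}\partial_k$, and $d'=\sum_{k=1}^{n-1}\varepsilon_{e_k}\partial_k$, $\delta'=-\sum_{k=1}^{n-1}i_{e_k}\partial_k$ are the tangential operators; $\Delta'=\sum_{k=1}^{n-1}\partial_k^2$ acts componentwise. Define on $p$-forms $$\begin{aligned}P^p(\lambda)=&-(2\lambda-n-2)(\lambda-n+p-1)(\lambda-p)\partial_n-(2\lambda-n-2)\big[(\lambda-n+p)\varepsilon_{e_n}\delta+(\lambda-p)d\,i_{e_n}\big]\\&-(\lambda-n+p-1)(\lambda-p)x_n\delta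 d-(\lambda-n+p)(\lambda-p-1)x_nd\delta\end{aligned}$$ and the Bernstein-Sato family for differential forms (of first type) $$D_N^{BS,(p\to p)}(\lambda)=\iota^*P^p(\lambda-N+1)\circ\cdots\circ P^p(\lambda-1)\circ P^p(\lambda)$$ ($N$ factors). Let $$D_{2N}(\lambda)=\sum_{k=0}^Na_k^{(N)}(-\lambda)(\Delta')^k\iota^*\partial_n^{2N-2k},\qquad D_{2N+1}(\lambda)=\sum_{k=0}^Nb_k^{(N)}(-\lambda)(\Delta')^k\iota^*\partial_n^{2N-2k+1},$$ $$a_j^{(N)}(\lambda)=\frac{(-2)^{N-j}N!}{j!(2N-2j)!}\prod_{k=j}^{N-1}(2\lambda-4N+2k+n+1),\qquad b_j^{(N)}(\lambda)=\frac{(-2)^{N-j}N!}{j!(2N-2j+1)!}\prod_{k=j}^{N-1}(2\lambda-4N+2k+n-1)$$ (empty products equal $1$), where $\iota^*$ is pull-back of forms and $\partial_n$ acts componentwise. The conformal symmetry breaking differential operators on forms are $$D_{2N}^{(p\to p)}(\lambda)=(p-\lambda-2N)D_{2N}(\lambda)+2N(2\lambda-n+2N+1)D_{2N-1}(\lambda+1)d'i_{e_n}-2N\,D_{2N-2}(\lambda+1)d'\delta',$$ $$D_{2N+1}^{(p\to p)}(\lambda)=(p-\lambda-2N-1)D_{2N+1}(\lambda)+D_{2N}(\lambda+1)d'i_{e_n}-2N\,D_{2N-1}(\lambda+1)d'\delta'.$$ *)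

(* Defs.v *)
From HB Require Import structures.
From mathcomp Require Import all_boot all_order all_algebra.
From mathcomp Require Import all_classical all_reals all_analysis.
From mathcomp Require Import complex.

Set Implicit Arguments.
Unset Strict Implicit.
Unset Printing Implicit Defensive.

Import Order.TTheory GRing.Theory Num.Theory.
Import numFieldNormedType.Exports.

Local Open Scope ring_scope.
Local Open Scope complex_scope.

Section Smooth.
Variables (R : realType) (n : nat).

Definition basis_vec (k : 'I_n) : 'rV[R]_n := delta_mx 0 k.

Fixpoint Ck (r : nat) (f : 'rV[R]_n -> R) : Prop :=
  if r is r'.+1 then
    [/\ continuous f,
        (forall (k : 'I_n) (x : 'rV[R]_n), derivable f x (basis_vec k)) &
        (forall k : 'I_n, Ck r' (fun x => 'D_(basis_vec k) f x))]
  else continuous f.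

Definition smooth (f : 'rV[R]_n -> R[i]) : Prop :=
  forall r : nat, Ck r (fun x => complex.Re (f x)) /\ Ck r (fun x => complex.Im (f x)).

Definition partial (k : 'I_n) (f : 'rV[R]_n -> R[i]) (x : 'rV[R]_n) : R[i] :=
  ('D_(basis_vec k) (fun y => complex.Re (f y)) x)
  +i* ('D_(basis_vec k) (fun y => complex.Im (f y)) x).

End Smooth.

(* A field of complex-valued functions of finitely many vectors: [w x s] is the
   value at the point [x] on the vectors listed in [s].  A homogeneous form of
   degree p vanishes on the lists of length different from p, so forms of all
   degrees share one type and the operators below need no degree index. *)
Definition dform (R : realType) (n : nat) :=
  'rV[R]_n -> seq 'rV[R]_n -> R[i]^o.

(* Omega^p(R^n): smooth alternating forms of degree p, complex coefficients. *)
Record is_diff_form (R : realType) (n p : nat) (w : dform R n) : Prop :=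
  IsDiffForm {
    diff_form_degree : forall x s, size s != p -> w x s = 0;
    diff_form_linear : forall x s1 s2 (a : R) u v,
      w x (s1 ++ (a *: u + v) :: s2) =
      a%:C * w x (s1 ++ u :: s2) + w x (s1 ++ v :: s2);
    diff_form_alternating : forall x s1 s2 s3 v,
      w x (s1 ++ v :: s2 ++ v :: s3) = 0;
    diff_form_smooth : forall s, smooth (fun x => w x s)
  }.

Section FormOperators.
Variables (R : realType) (n : nat).
Implicit Types (w : dform R n) (k : 'I_n).

Definition fpartial k w : dform R n := fun x s => partial k (fun y => w y s) x.

Definition int_prod k w : dform R n := fun x s => w x (basis_vec R k :: s).

(* (e^k /\ w)(v_0, ..., v_p)
     = \sum_i (-1)^i (v_i)_k w(v_0, ..., v_(i-1), v_(i+1), ..., v_p),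
   normalised so that i_(e_k) and eps_(e_l) anticommute to delta_kl. *)
Definition ext_prod k w : dform R n := fun x s =>
  \sum_(i < size s)
    (-1) ^+ i * ((nth 0 s i) ord0 k)%:C * w x (take i s ++ drop i.+1 s).

Definition coord_mul k w : dform R n := fun x s => (x ord0 k)%:C * w x s.

Definition ext_d w : dform R n := \sum_(k < n) ext_prod k (fpartial k w).

Definition codiff w : dform R n := - \sum_(k < n) int_prod k (fpartial k w).

Definition laplacian w : dform R n := \sum_(k < n) fpartial k (fpartial k w).

End FormOperators.

(* From here on the ambient space is R^n with n = m.+1, the hyperplane is R^m,
   and [ord_max : 'I_m.+1] is the index of the normal coordinate x_n. *)
Section Hyperplane.
Variables (R : realType) (m : nat).

Definition iota_hyp (y : 'rV[R]_m) : 'rV[R]_m.+1 :=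
  \row_j oapp (fun i => y ord0 i) 0 (unlift ord_max j).

(* iota is linear, hence equal to its own differential. *)
Definition pullback (w : dform R m.+1) : dform R m :=
  fun y s => w (iota_hyp y) (map iota_hyp s).

Definition tan_d (w : dform R m.+1) : dform R m.+1 :=
  \sum_(k < m) ext_prod (lift ord_max k) (fpartial (lift ord_max k) w).

Definition tan_codiff (w : dform R m.+1) : dform R m.+1 :=
  - \sum_(k < m) int_prod (lift ord_max k) (fpartial (lift ord_max k) w).

End Hyperplane.

Definition pochhammer (K : fieldType) (a : K) (r : nat) : K :=
  \prod_(i < r) (a + i%:R).

Fixpoint double_fact (r : nat) : nat :=
  if r is r'.+2 then (r'.+2 * double_fact r')%N else 1%N.

Section Families.
Variables (R : realType) (m : nat).
Local Notation n := (m.+1).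
Implicit Types (l : R[i]) (N p : nat) (w : dform R m.+1).

Local Notation dn := (fpartial ord_max).
Local Notation in_ := (int_prod ord_max).
Local Notation epsn := (ext_prod ord_max).
Local Notation xn := (coord_mul ord_max).

Definition P_op p l w : dform R m.+1 :=
  - ((2 * l - n%:R - 2) * (l - n%:R + p%:R - 1) * (l - p%:R)) *: dn w
  - (2 * l - n%:R - 2) *:
      ((l - n%:R + p%:R) *: epsn (codiff w) + (l - p%:R) *: ext_d (in_ w))
  - ((l - n%:R + p%:R - 1) * (l - p%:R)) *: xn (codiff (ext_d w))
  - ((l - n%:R + p%:R) * (l - p%:R - 1)) *: xn (ext_d (codiff w)).

Fixpoint P_comp N p l w : dform R m.+1 :=
  if N is N'.+1 then P_op p (l - N'%:R) (P_comp N' p l w) else w.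

Definition D_BS N p l w : dform R m := pullback (P_comp N p l w).

Definition a_coef N j l : R[i] :=
  (- 2) ^+ (N - j) * (N`!)%:R / ((j`!)%:R * ((2 * N - 2 * j)`!)%:R)
  * \prod_(j <= k < N) (2 * l - 4 * N%:R + 2 * k%:R + n%:R + 1).

Definition b_coef N j l : R[i] :=
  (- 2) ^+ (N - j) * (N`!)%:R / ((j`!)%:R * ((2 * N - 2 * j + 1)`!)%:R)
  * \prod_(j <= k < N) (2 * l - 4 * N%:R + 2 * k%:R + n%:R - 1).

Definition D_even N l w : dform R m :=
  \sum_(k < N.+1) a_coef N k (- l) *:
    iter k (@laplacian R m) (pullback (iter (2 * N - 2 * k) dn w)).

Definition D_odd N l w : dform R m :=
  \sum_(k < N.+1) b_coef N k (- l) *: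
    iter k (@laplacian R m) (pullback (iter (2 * N - 2 * k + 1) dn w)).

(* D_r(l) for every r; a truncated index 2N-1 or 2N-2 with N = 0 only occurs
   below multiplied by the factor 2N = 0. *)
Definition D_fam (r : nat) l w : dform R m :=
  if odd r then D_odd r./2 l w else D_even r./2 l w.

Definition D_pp_even N p l w : dform R m :=
  (p%:R - l - (2 * N)%:R) *: D_fam (2 * N) l w
  + ((2 * N)%:R * (2 * l - n%:R + (2 * N)%:R + 1)) *:
      D_fam (2 * N - 1) (l + 1) (tan_d (in_ w))
  - (2 * N)%:R *: D_fam (2 * N - 2) (l + 1) (tan_d (tan_codiff w)).

Definition D_pp_odd N p l w : dform R m :=
  (p%:R - l - (2 * N)%:R - 1) *: D_fam (2 * N + 1) l w
  + D_fam (2 * N) (l + 1) (tan_d (in_ w))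
  - (2 * N)%:R *: D_fam (2 * N - 1) (l + 1) (tan_d (tan_codiff w)).

End Families.

(* Main.v *)
Require Import Defs.
From HB Require Import structures.
From mathcomp Require Import all_boot all_order all_algebra.
From mathcomp Require Import all_classical all_reals all_analysis.
From mathcomp Require Import complex ring lra zify.

Set Implicit Arguments.
Unset Strict Implicit.
Unset Printing Implicit Defensive.

Import Order.TTheory GRing.Theory Num.Theory.
Import numFieldNormedType.Exports.
Local Open Scope ring_scope.
Local Open Scope complex_scope.

(** Why the theorem holds.

    Write [alpha = lam - n + p] and [beta = lam - p].  The first-order family
    composes as [D_BS (r+1)] at [lam] equals [D_BS r] at [lam - 1] after one
    factor [P(lam)], so the theorem follows by induction on the number [r] of
    factors once one knows how the symmetry breaking operator of order [r]
    behaves under composition with [P(lam)].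

    Put [S = d' i_n] and [T = d' delta'].  Three functionals describe the
    operator of order [r]: the pull-backs of [dn^j Delta'^k w],
    [dn^j Delta'^k (S w)] and [dn^j Delta'^k (T w)].  The key observation is
    that all coefficients come from one sequence [e_k = gcoef r k c], with
    [c = 2 lam - n - 2 r + 1]:

      sum_k e_k ( a     [dn^(r-2k) Delta'^k w]
                + (r-2k) [dn^(r-2k-1) Delta'^k S w]
                - 2k     [dn^(r-2k) Delta'^(k-1) T w] ),   a = alpha - r.

    In other words the operator is [a D + (dD/d dn) S - 2 (dD/d Delta') T],
    where [D] is the scalar operator with coefficients [e_k] ([qsum_fsum]).  In
    this form [a] and [c] do not change in the induction step: lowering [lam]
    by one compensates the raised order.

    Modulo everything the pull-back kills (a factor [x_n] or [eps_n] on the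
    left), composing the three functionals with [P(lam)] gives the three rules
    [psi_bs_op], [psi_dti_bs_op], [psi_dtct_bs_op]; they use only the
    (anti)commutation relations of [dn, x_n, i_n, eps_n, d', delta'].  With them
    the induction step [qsum_bs_op] reduces to the single recurrence [gcoef_rec]
    between the coefficients of orders [r] and [r+1], up to a telescoping sum
    ([step_sum]).  The scalar picked up at each step is
    [step_factor c r * (alpha - 1) * beta], and the product of these scalars is
    the constant of the theorem ([bs_constS]).

    The analysis is confined to establishing the relations on smooth forms.
    The only nontrivial one is the symmetry of second partial derivatives
    ([schwarz]), behind [d' d' = 0] and the commutation of [dn] with the
    tangential operators.  Smooth forms are packaged as a module [sform], on
    which all operators are linear. *)

(** * Coefficients of the scalar families *)

Section ScalarCoefficients.
Variables (K : numFieldType) (c : K).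

(** With [r = 2N] or [r = 2N+1] and [c = 2 nu - 2 r + n + 1] this is the
    coefficient [a_k^(N)(nu)], respectively [b_k^(N)(nu)]: in terms of [c] the two
    products agree.  The value 0 beyond [k = r/2] lets sums over [k] run
    over any larger range. *)
Definition gcoef (r k : nat) (c : K) : K :=
  if (k.*2 <= r)%N then
    (- 2) ^+ (r./2 - k) * (r./2)`!%:R / (k`!%:R * (r - k.*2)`!%:R)
    * \prod_(k <= i < r./2) (c + (i.*2)%:R)
  else 0.

Lemma gcoef_out r k : (r < k.*2)%N -> gcoef r k c = 0.
Proof. by move=> h; rewrite /gcoef leqNgt h. Qed.

Lemma gcoefE j k b : gcoef (j + k.*2) k b =
  (- 2) ^+ j./2 * (j./2 + k)`!%:R / (k`!%:R * j`!%:R)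
    * \prod_(k <= i < j./2 + k) (b + (i.*2)%:R).
Proof.
rewrite /gcoef leq_addl halfD odd_double andbF add0n doubleK.
by rewrite !addnK.
Qed.

Lemma gcoef_diag k : gcoef k.*2 k c = 1.
Proof.
rewrite -[k.*2]add0n gcoefE big_geq // expr0 mul1r mulr1 mulr1.
by rewrite divff // pnatr_eq0 -lt0n fact_gt0.
Qed.

Let factS_neq0 n : (n`!)%:R != 0 :> K.
Proof. by rewrite pnatr_eq0 -lt0n fact_gt0. Qed.

(** The two sides vanish together at the end of the range, where [k] or [k+1]
    leaves it, so the recurrence in [k] holds for every [k]. *)
Lemma gcoef_row r k :
  (r%:R - k.*2%:R) * (r%:R - k.*2%:R - 1) * gcoef r k c =
  - 2 * k.+1%:R * (c + k.*2%:R) * gcoef r k.+1 c.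
Proof.
have [h|h] := leqP k.+1.*2 r; last first.
  rewrite (gcoef_out h) mulr0.
  have [h2|h2] := leqP k.*2 r; last by rewrite (gcoef_out h2) mulr0.
  have : (r == k.*2) || (r == k.*2.+1) by lia.
  by case/orP => /eqP ->; rewrite -?natr1; ring.
have [j ->] : exists j, r = (j + k.+1.*2)%N by exists (r - k.+1.*2)%N; lia.
have -> : (j + k.+1.*2 = j.+2 + k.*2)%N by lia.
rewrite gcoefE; have -> : (j.+2 + k.*2 = j + k.+1.*2)%N by lia.
rewrite gcoefE /= !addSn addnS (big_ltn (m := k)) ?ltnS ?leq_addl //.
move: (\prod_(_ <= i < _) _) => pr.
rewrite exprS !factS !natrM natrD doubleS -!natr1.
have := factS_neq0 (j./2 + k); have := factS_neq0 k; have := factS_neq0 j.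
have : j.+1%:R != 0 :> K by rewrite pnatr_eq0.
have : j.+2%:R != 0 :> K by rewrite pnatr_eq0.
have : k.+1%:R != 0 :> K by rewrite pnatr_eq0.
rewrite -!natr1 => *; field; do ?[apply/andP; split=> //].
Qed.

(** Passing from even to odd order only changes the factorial [(r - 2k)!];
    from odd to even order the product also gains its last factor. *)
Lemma gcoef_succ r k : (k.*2 <= r)%N ->
  (r.+1%:R - k.*2%:R) * gcoef r.+1 k c =
  (if odd r then r.+1%:R * (1 - c - r%:R) else 1) * gcoef r k c.
Proof.
move=> h; have [j ->] : exists j, r = (j + k.*2)%N by exists (r - k.*2)%N; lia.
rewrite -addSn !gcoefE oddD odd_double addbF.
have := odd_double_half j; case: (odd j) => /= hj.
  have e : uphalf j = (j./2).+1 by lia.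
  rewrite e !addSn (big_nat_recr (j./2 + k)) ?leq_addl //=.
  move: (\prod_(_ <= i < _) _) => pr; rewrite !factS -[in _.*2%:R]muln2.
  have := factS_neq0 j; have := factS_neq0 k.
  have : j.+1%:R != 0 :> K by rewrite pnatr_eq0.
  have ej : j%:R = 1 + 2 * (j./2)%:R :> K.
    by rewrite -[in LHS]hj natrD -mul2n natrM.
  rewrite !natrM -![(_ + _).+1%:R]natr1 -[j.+1%:R]natr1 -!muln2.
  rewrite !natrM !natrD !natrM ej exprS.
  move=> *; field; do ?[apply/andP; split=> //].
have -> : uphalf j = j./2 by lia.
have := factS_neq0 j; have := factS_neq0 k.
have : j.+1%:R != 0 :> K by rewrite pnatr_eq0.
rewrite factS natrM natrD => *; field; rewrite ?nat1r; do ?[apply/andP; split=> //].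
Qed.

(** The scalar operator of order [r - 2] at the shifted parameter is the
    derivative of the one of order [r] with respect to the Laplacian. *)
Lemma gcoef_shift r k : (k.+1.*2 <= r)%N ->
  (r./2)%:R * gcoef (r - 2) k (c + 2) = k.+1%:R * gcoef r k.+1 c.
Proof.
move=> h; have [j ->] : exists j, r = (j + k.+1.*2)%N by exists (r - k.+1.*2)%N; lia.
have -> : (j + k.+1.*2 - 2 = j + k.*2)%N by lia.
have -> : ((j + k.+1.*2)./2 = (j./2 + k).+1)%N by lia.
rewrite !gcoefE addnS big_add1 /=.
have -> : \prod_(k <= i < j./2 + k) (c + 2 + i.*2%:R) =
          \prod_(k <= i < j./2 + k) (c + i.+1.*2%:R).
  by apply: eq_bigr => i _; rewrite doubleS -addn2 natrD; ring.
move: (\prod_(_ <= i < _) _) => pr; rewrite !factS !natrM.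
have := factS_neq0 j; have := factS_neq0 k; have := factS_neq0 (j./2 + k).
have : k.+1%:R != 0 :> K by rewrite pnatr_eq0.
move=> *; field; rewrite ?nat1r; do ?[apply/andP; split=> //].
Qed.

End ScalarCoefficients.

(** * The induction step as an identity of sums *)

Section InductionStep.
Variables (K : numFieldType).

(** Together with [(al - 1) * be], the scalar relating the composition of the
    operator of order [r] with one more factor to the operator of order [r + 1]. *)
Definition step_factor (c : K) (r : nat) : K :=
  if odd r then 1 else r.+1%:R * (1 - c - r%:R).

Definition gcoef_prev (r k : nat) (c : K) : K := if k is k'.+1 then gcoef r k' c else 0.

(** Inside the range, multiply by [r + 1 - 2k], which is nonzero: by
    [gcoef_succ] and [gcoef_row] every term becomes a multiple of
    [gcoef r k c].  The bracket is then [(r + 1) (1 - c - r)] for every [k].  Just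
    outside, at [2k = r + 1], both sides reduce to the leading coefficient 1. *)
Lemma gcoef_rec c r k :
  (r%:R - k.*2%:R - (c - 1 + 2 * r%:R)) * gcoef r k c
  + (r%:R - k.*2%:R + 2) * gcoef_prev r k c = step_factor c r * gcoef r.+1 k c.
Proof.
have [h|h] := leqP k.*2 r.
  have nz : (r.+1%:R - k.*2%:R) != 0 :> K by rewrite subr_eq0 eqr_nat; lia.
  apply: (mulfI nz); rewrite mulrCA gcoef_succ // mulrDr.
  have -> : (r.+1%:R - k.*2%:R) * ((r%:R - k.*2%:R + 2) * gcoef_prev r k c)
     = - 2 * k%:R * (c + k.*2%:R - 2) * gcoef r k c.
    case: k {h nz} => [|k] /=; first by ring.
    rewrite doubleS -[k.*2.+2]addn2 natrD.
    have := gcoef_row c r k; rewrite -natr1 => e.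
    transitivity ((r%:R - k.*2%:R) * (r%:R - k.*2%:R - 1) * gcoef r k c); first by ring.
    by rewrite e; ring.
  by rewrite /step_factor; case: (odd r); rewrite -natr1 -muln2 natrM; ring.
rewrite (gcoef_out _ h) mulr0 add0r.
case: k h => [|k] //= h.
have [h2|h2] := leqP k.+1.*2 r.+1; last first.
  rewrite (gcoef_out _ h2) mulr0.
  have [h3|h3] := leqP k.*2 r; last by rewrite (gcoef_out _ h3) mulr0.
  have -> : r = k.*2 by lia.
  by rewrite doubleS -[k.*2.+2]addn2 natrD; ring.
have -> : r = k.*2.+1 by lia.
rewrite -doubleS gcoef_diag /step_factor /= odd_double /= !mulr1.
have := gcoef_succ c (leqnn k.*2); rewrite gcoef_diag odd_double mul1r.
rewrite -natr1 addrAC subrr add0r mul1r => ->.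
by rewrite doubleS -[k.*2.+2]addn2 -natr1 natrD; ring.
Qed.

(** [F k], [G k], [H k] stand for the three functionals multiplying the [k]-th
    coefficients of order [r + 1].  After eliminating the coefficients of order
    [r + 1] by [gcoef_rec], the difference of the [k]-th summands is
    [R (k + 1) - R k], where [R k] collects what the coefficient [e_(k-1)]
    contributes to [F k], [G k] and [H (k - 1)]. *)
Lemma step_sum (F G H : nat -> K) (r : nat) (al be c : K) :
  let ga := al + be - 2 in let a := al - 1 - r%:R in
  let j k := r%:R - k.*2%:R in
  c = ga + 1 - 2 * r%:R ->
  \sum_(k < r.+1) gcoef r k c *
   (a * ((al - 1) * be * ((j k - ga) * F k + j k * F k.+1)
         - (ga * be + (al - be) * j k) * G k + (al - be) * j k * H k)
    + j k * (al * (be - 1) * (j k - 1 - ga) * G k + (al - 1) * be * (j k - 1) * G k.+1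
            + ((al - be) * (j k - 1) - ga * al) * H k)
    - 2 * k%:R * ((al - 1) * be * (j k - ga) * H k.-1 + al * (be - 1) * j k * H k
            + ((al - be) * j k + ga * be) * G k))
  = step_factor c r * (al - 1) * be *
    \sum_(k < r.+2) gcoef r.+1 k c *
      (a * F k + (r.+1%:R - k.*2%:R) * G k - 2 * k%:R * H k.-1).
Proof.
move=> ga a j ec.
pose R k := (al - 1) * be * (j k + 2) * gcoef_prev r k c *
            (a * F k + (j k + 1) * G k - 2 * k%:R * H k.-1).
rewrite [LHS](_ : _ = \sum_(k < r.+2) gcoef r k c *
   (a * ((al - 1) * be * ((j k - ga) * F k + j k * F k.+1)
         - (ga * be + (al - be) * j k) * G k + (al - be) * j k * H k)
    + j k * (al * (be - 1) * (j k - 1 - ga) * G k + (al - 1) * be * (j k - 1) * G k.+1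
            + ((al - be) * (j k - 1) - ga * al) * H k)
    - 2 * k%:R * ((al - 1) * be * (j k - ga) * H k.-1 + al * (be - 1) * j k * H k
            + ((al - be) * j k + ga * be) * G k))); last first.
  by rewrite [RHS]big_ord_recr /= (@gcoef_out _ c r) ?mul0r ?addr0 //; lia.
apply/eqP; rewrite -subr_eq0 mulr_sumr -sumrB; apply/eqP.
transitivity (\sum_(0 <= k < r.+2) (R k.+1 - R k)); last first.
  rewrite telescope_sumr // /R /gcoef_prev (@gcoef_out _ c r) ?mulr0 ?mul0r ?subr0 //.
  by lia.
rewrite big_mkord; apply: eq_bigr => k _; move: (val k) => {}k.
have := gcoef_rec c r k.
have e1 : j k.+1 = j k - 2 by rewrite /j doubleS -[k.*2.+2]addn2 natrD; ring.
have e2 : r.+1%:R - k.*2%:R = j k + 1 by rewrite /j -natr1; ring.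
have ek : 2 * k%:R = r%:R - j k by rewrite /j -muln2 natrM; ring.
rewrite {}e2.
have -> : j k - ga = r%:R - k.*2%:R - (c - 1 + 2 * r%:R) by rewrite /j ec; ring.
rewrite -/(j k) => rec.
have -> : forall x y, step_factor c r * (al - 1) * be * (gcoef r.+1 k c * (x + y))
   = (al - 1) * be * (step_factor c r * gcoef r.+1 k c) * (x + y) by move=> x y; ring.
rewrite -rec /R e1 /=.
have ek1 : 2 * k.+1%:R = r%:R - j k + 2 by rewrite -ek -natr1; ring.
rewrite ek1 ek ec /a /ga.
by move: (j k) (gcoef r k c) (gcoef_prev r k c) => jk g g'; ring.
Qed.
End InductionStep.

(** * The normalising constant *)

Section NormalisingConstant.
Variable K : numFieldType.
Implicit Types a al be c : K.

Lemma pochhammer_recr a r : pochhammer a r.+1 = pochhammer a r * (a + r%:R).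
Proof. by rewrite /pochhammer big_ord_recr. Qed.

(** The constant of the theorem for [r] factors, uniformly in the parity of
    [r], with [al = lam - n + p] and [be = lam - p]. *)
Definition bs_const al be (r : nat) : K :=
  (- 2) ^+ uphalf r * pochhammer ((al + be) / 2 - r%:R) (uphalf r)
  * (double_fact (uphalf r).*2.-1)%:R
  * pochhammer (al - r%:R + 1) r.-1 * pochhammer (be - r%:R + 1) r.

Lemma bs_const1 al be : bs_const al be 1 = - (al + be - 2) * be.
Proof.
by rewrite /bs_const /pochhammer /= !big_ord1 big_ord0 /=; field.
Qed.

(** The step factor is 1 when [r] is odd, and the half-integer Pochhammer symbol
    and the double factorial gain a factor exactly when [r] is even. *)
Lemma bs_constS al be r : (0 < r)%N ->
  bs_const al be r.+1 = bs_const (al - 1) (be - 1) r *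
    (step_factor (al + be - 1 - 2 * r%:R) r * (al - 1) * be).
Proof.
case: r => // r _; rewrite /bs_const [r.+2.-1]/= [r.+1.-1]/=.
rewrite (pochhammer_recr (_ - r.+2%:R + 1) r) (pochhammer_recr (be - _ + 1) r.+1).
have e1 : al - r.+2%:R + 1 = al - 1 - r.+1%:R + 1 by rewrite -!natr1; ring.
have e2 : be - r.+2%:R + 1 = be - 1 - r.+1%:R + 1 by rewrite -!natr1; ring.
have e3 : (al + be) / 2 - r.+2%:R = (al - 1 + (be - 1)) / 2 - r.+1%:R.
  by rewrite -!natr1; field.
rewrite e1 e2 e3 /step_factor.
have -> : uphalf r.+2 = if odd r.+1 then uphalf r.+1 else (uphalf r.+1).+1.
  by case: ifP; lia.
have : ~~ odd r.+1 -> r.+1 = (uphalf r.+1).*2 by lia.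
have : uphalf r.+1 != 0%N by [].
move: (uphalf r.+1) => h h_neq0; case: (odd r.+1) => [_|/(_ isT) er].
  by rewrite -!natr1; ring.
rewrite pochhammer_recr exprS.
have -> : h.+1.*2.-1 = (h.*2.-1).+2 by lia.
rewrite [double_fact _.+2]/= natrM.
have -> : (h.*2.-1).+2%:R = r.+2%:R :> K by congr (_%:R); lia.
have er' : r%:R = 2 * h%:R - 1 :> K by rewrite -natrM mul2n -er -natr1 addrK.
by rewrite -!natr1 er'; field.
Qed.
End NormalisingConstant.

(** * Composition with one more factor, algebraically *)

Section OperatorAlgebra.
Variables (K : numFieldType) (V : lmodType K).
(** The normal derivative, multiplication by the normal coordinate, the
    tangential differential and codifferential, and the interior and exterior
    products with the normal vector. *)
Variables (dn xn dt ct in_ en : {linear V -> V}).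
Hypothesis dn_xn : forall v, dn (xn v) = v + xn (dn v).
Hypothesis dn_dt : forall v, dn (dt v) = dt (dn v).
Hypothesis dn_ct : forall v, dn (ct v) = ct (dn v).
Hypothesis dn_in : forall v, dn (in_ v) = in_ (dn v).
Hypothesis dn_en : forall v, dn (en v) = en (dn v).
Hypothesis dt_xn : forall v, dt (xn v) = xn (dt v).
Hypothesis ct_xn : forall v, ct (xn v) = xn (ct v).
Hypothesis in_xn : forall v, in_ (xn v) = xn (in_ v).
Hypothesis in_en : forall v, in_ (en v) = v - en (in_ v).
Hypothesis dt_en : forall v, dt (en v) = - en (dt v).
Hypothesis ct_en : forall v, ct (en v) = - en (ct v).
Hypothesis in_dt : forall v, in_ (dt v) = - dt (in_ v).
Hypothesis dt_dt : forall v, dt (dt v) = 0.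
Definition lap v := - (dt (ct v) + ct (dt v)).
Hypothesis lap_ct : forall v, lap (ct v) = ct (lap v).
Hypothesis lap_in : forall v, lap (in_ v) = in_ (lap v).
(** The functional [phi] will be the value of the pull-back at a point on a
    list of vectors; it kills what has [x_n] or [eps_n] as a left factor. *)
Variable phi : V -> K.
Hypothesis phiP : forall a u v, phi (a *: u + v) = a * phi u + phi v.
Hypothesis phi_xn : forall v, phi (xn v) = 0.
Hypothesis phi_en : forall v, phi (en v) = 0.

(** The full differential and codifferential, split into tangential and normal
    parts. *)
Definition dtot v := dt v + en (dn v).
Definition ctot v := ct v - in_ (dn v).
(** The factor [P(lam)] in terms of [al = lam - n + p] and [be = lam - p], so that
    [2 lam - n - 2 = al + be - 2]. *)
Definition bs_op (al be : K) v :=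
  - ((al + be - 2) * (al - 1) * be) *: dn v
  - (al + be - 2) *: (al *: en (ctot v) + be *: dtot (in_ v))
  - ((al - 1) * be) *: xn (ctot (dtot v))
  - (al * (be - 1)) *: xn (dtot (ctot v)).

(** The Laplacian acts first: it commutes with all the operators, so that only the
    powers of [dn] interact with [x_n]. *)
Definition psi j k v := phi (iter j dn (iter k lap v)).

Let lapP a u v : lap (a *: u + v) = a *: lap u + lap v.
Proof. by rewrite /lap !linearP /= addrACA -scalerDr opprD scalerN. Qed.

Let iter_linear (f : V -> V) : (forall a u v, f (a *: u + v) = a *: f u + f v) ->
  forall j a u v, iter j f (a *: u + v) = a *: iter j f u + iter j f v.
Proof. by move=> fP; elim=> // j IH a u v; rewrite !iterS IH fP. Qed.

Let psiP j k a u v : psi j k (a *: u + v) = a * psi j k u + psi j k v.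
Proof. by rewrite /psi (iter_linear lapP) (iter_linear (fun a u v => linearP dn a u v)) phiP. Qed.

Section LinearFunctional.
Variables (U : lmodType K) (f : U -> K).
Hypothesis fP : forall a u v, f (a *: u + v) = a * f u + f v.
Lemma lf0 : f 0 = 0.
Proof. by have := fP (-1) 0 0; rewrite scaler0 addr0 mulN1r addNr. Qed.
Lemma lfD u v : f (u + v) = f u + f v.
Proof. by have := fP 1 u v; rewrite scale1r mul1r. Qed.
Lemma lfZ a u : f (a *: u) = a * f u.
Proof. by have := fP a u 0; rewrite !addr0 lf0 addr0. Qed.
Lemma lfN u : f (- u) = - f u.
Proof. by rewrite -scaleN1r lfZ mulN1r. Qed.
End LinearFunctional.

Let iter_comm (f g : V -> V) : (forall v, f (g v) = g (f v)) ->
  forall j v, iter j f (g v) = g (iter j f v).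
Proof. by move=> fg; elim=> // j IH v; rewrite !iterS IH fg. Qed.

Lemma psi_en j k v : psi j k (en v) = 0.
Proof.
rewrite /psi (iter_comm (g := en)) => [|u].
  by rewrite (iter_comm dn_en) phi_en.
by rewrite /lap ct_en dt_en !linearN dt_en ct_en !opprK (linearD en).
Qed.

Lemma psi_dn j k v : psi j k (dn v) = psi j.+1 k v.
Proof.
rewrite /psi iterSr; congr (phi (iter j dn _)); apply: iter_comm => u.
by rewrite /lap (linearN dn) (linearD dn) dn_dt dn_ct dn_ct dn_dt.
Qed.

Lemma psi_lap j k v : psi j k (lap v) = psi j k.+1 v.
Proof. by rewrite /psi iterSr. Qed.

(** Leibniz: each of the [j] normal derivatives may absorb the factor [x_n], and
    the term in which none does is killed by [phi]. *)
Lemma psi_xn j k v : psi j k (xn v) = j%:R * psi j.-1 k v.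
Proof.
rewrite /psi (iter_comm (g := xn)) => [|u]; last first.
  by rewrite /lap !(ct_xn, dt_xn) (linearN xn) (linearD xn).
move: (iter k lap v) => {}v.
have -> : iter j dn (xn v) = j%:R *: iter j.-1 dn v + xn (iter j dn v).
  elim: j => [|j IH]; first by rewrite scale0r add0r.
  rewrite [LHS]iterS IH linearD linearZ dn_xn addrA; congr (_ + _).
  rewrite -[X in _ + X]scale1r -natr1 scalerDl /=; congr (_ + _).
  by case: j {IH} => [|j]; rewrite ?scale0r //= -iterS.
by rewrite phiP phi_xn addr0.
Qed.

(** The operators [S = d' i_n] and [T = d' delta']. *)
Definition dti v := dt (in_ v).
Definition dtct v := dt (ct v).

(** Moving [eps_n] to the left of everything writes a factor as terms without
    [eps_n], plus [eps_n] times a remainder.  The remainder has to be kept for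
    functionals that first apply [S] or [T]. *)
Lemma lf_bs_op (f : V -> K) al be v :
  (forall a u v, f (a *: u + v) = a * f u + f v) ->
  f (bs_op al be v) =
  - (al + be - 2) * (al - 1) * be * f (dn v) - (al + be - 2) * be * f (dti v)
  + (al - 1) * be * (f (xn (lap v)) + f (xn (dn (dn v))))
  + (al - be) * (f (xn (dtct v)) - f (xn (dti (dn v))))
  - (al + be - 2) * al * f (en (ct v))
  + (al + be - 2) * (al - be) * f (en (in_ (dn v)))
  + (al - be) * (f (xn (en (ct (dn v)))) - f (xn (en (in_ (dn (dn v)))))).
Proof.
move=> fP; rewrite /bs_op /dtot /ctot /lap /dti /dtct.
pose lin := (linearD dt, linearD ct, linearD in_, linearD en, linearD xn, linearD dn,
  linearN dt, linearN ct, linearN in_, linearN en, linearN xn, linearN dn).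
rewrite !lin !(in_en, ct_en, in_dt, dn_in, dn_dt, dn_ct, dn_en).
rewrite !lin ?(in_en, ct_en, in_dt, dn_in, dn_dt, dn_ct, dn_en).
rewrite ?lin.
rewrite !(lfD fP, lfN fP, lfZ fP, lfN fP).
ring.
Qed.

Let psi_xn_dn j k v : psi j k (xn (dn v)) = j%:R * psi j k v.
Proof. by rewrite psi_xn; case: j => [|j]; rewrite ?mul0r // psi_dn. Qed.

Let lap_dt v : lap (dt v) = dt (lap v).
Proof. by rewrite /lap dt_dt linear0 addr0 linearN linearD dt_dt add0r. Qed.

Let psi_dt_en j k v : psi j k (dt (en v)) = 0.
Proof. by rewrite dt_en (lfN (@psiP j k)) psi_en oppr0. Qed.

(** All terms with [eps_n] on the left die. *)
Lemma psi_bs_op j k al be v : psi j k (bs_op al be v) =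
  (al - 1) * be * ((j%:R - (al + be - 2)) * psi j.+1 k v + j%:R * psi j.-1 k.+1 v)
  - ((al + be - 2) * be + (al - be) * j%:R) * psi j k (dti v)
  + (al - be) * j%:R * psi j.-1 k (dtct v).
Proof.
have dti_dn : dti (dn v) = dn (dti v) by rewrite /dti dn_dt dn_in.
rewrite (lf_bs_op _ _ _ (@psiP j k)) dti_dn !psi_en !psi_xn_dn !psi_xn !psi_en.
rewrite psi_dn psi_lap; ring.
Qed.

(** Here [S S = S T = 0] because [d' d' = 0], but [S eps_n] equals [d'] up to a
    term killed by the pull-back, so the [eps_n] terms contribute. *)
Lemma psi_dti_bs_op j k al be v : psi j k (dti (bs_op al be v)) =
  al * (be - 1) * (j%:R - (al + be - 2)) * psi j.+1 k (dti v)
  + (al - 1) * be * j%:R * psi j.-1 k.+1 (dti v)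
  + ((al - be) * j%:R - (al + be - 2) * al) * psi j k (dtct v).
Proof.
have fP a u w : psi j k (dti (a *: u + w)) = a * psi j k (dti u) + psi j k (dti w).
  by rewrite /dti !linearP psiP.
have dti_dn u : dti (dn u) = dn (dti u) by rewrite /dti dn_dt dn_in.
have dtct_dn u : dtct (dn u) = dn (dtct u) by rewrite /dtct dn_dt dn_ct.
have dti_xn u : dti (xn u) = xn (dti u) by rewrite /dti in_xn dt_xn.
have dti_dt u : dti (dt u) = 0 by rewrite /dti in_dt linearN dt_dt oppr0.
have dti_lap u : dti (lap u) = lap (dti u) by rewrite /dti -lap_in lap_dt.
have psi_en_dti i l u : psi i l (dti (en u)) = psi i l (dt u).
  by rewrite /dti in_en linearB (lfD (@psiP i l)) (lfN (@psiP i l)) psi_dt_en subr0.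
have psi0 i l : psi i l 0 = 0 := lf0 (@psiP i l).
rewrite (lf_bs_op _ _ _ fP) !dti_xn !dti_dn.
rewrite [dti (dti v)]dti_dt [dti (dtct v)]dti_dt !linear0 !psi0.
rewrite dti_lap !psi_xn_dn !psi_xn !psi_en_dti psi_lap psi_dn.
rewrite -![dt (ct _)]/(dtct _) -![dt (in_ _)]/(dti _) dtct_dn !dti_dn !psi_dn.
by case: j {fP} => [|j] /=; ring.
Qed.

(** [T] commutes with [eps_n], and [T S = - Delta' S], [T T = - Delta' T] because
    [d' delta' d' = - Delta' d']. *)
Lemma psi_dtct_bs_op j k al be v : psi j k (dtct (bs_op al be v)) =
  (al - 1) * be * (j%:R - (al + be - 2)) * psi j.+1 k (dtct v)
  + al * (be - 1) * j%:R * psi j.-1 k.+1 (dtct v)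
  + ((al - be) * j%:R + (al + be - 2) * be) * psi j k.+1 (dti v).
Proof.
have fP a u w : psi j k (dtct (a *: u + w)) = a * psi j k (dtct u) + psi j k (dtct w).
  by rewrite /dtct !linearP psiP.
have dti_dn u : dti (dn u) = dn (dti u) by rewrite /dti dn_dt dn_in.
have dtct_dn u : dtct (dn u) = dn (dtct u) by rewrite /dtct dn_dt dn_ct.
have dtct_xn u : dtct (xn u) = xn (dtct u) by rewrite /dtct ct_xn dt_xn.
have dtct_lap u : dtct (lap u) = lap (dtct u) by rewrite /dtct -lap_ct lap_dt.
have dtct_dt u : dtct (dt u) = - lap (dt u).
  by rewrite /lap dt_dt linear0 addr0 opprK.
have dtct_en u : dtct (en u) = en (dtct u).
  by rewrite /dtct ct_en linearN dt_en opprK.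
rewrite (lf_bs_op _ _ _ fP) !dtct_xn !dtct_lap !dti_dn !dtct_en !dtct_dn.
rewrite !psi_xn_dn !psi_xn !psi_en psi_dn psi_lap.
rewrite [dtct (dti v)]dtct_dt [dtct (dtct v)]dtct_dt.
have psiNlap i l u : psi i l (- lap u) = - psi i l.+1 u.
  by rewrite (lfN (@psiP _ _)) psi_lap.
rewrite !psiNlap -![dt (in_ _)]/(dti _) -![dt (ct _)]/(dtct _).
case: j {fP} => [|j] /=; ring.
Qed.

(** [a D + (dD/d dn) S - 2 (dD/d Delta') T] under [phi], where [D] is the operator
    with coefficients [gcoef r k c]. *)
Definition qsum (r : nat) (a c : K) v := \sum_(k < r.+1) gcoef r k c *
  (a * psi (r - k.*2) k v + (r%:R - k.*2%:R) * psi (r - k.*2).-1 k (dti v)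
   - 2 * k%:R * psi (r - k.*2) k.-1 (dtct v)).

Lemma qsum_bs_op r al be v :
  let a := al - 1 - r%:R in let c := al + be - 1 - 2 * r%:R in
  qsum r a c (bs_op al be v) = step_factor c r * (al - 1) * be * qsum r.+1 a c v.
Proof.
move=> a c; have ec : c = al + be - 2 + 1 - 2 * r%:R by rewrite /c; ring.
have := step_sum (fun k => psi (r.+1 - k.*2) k v) (fun k => psi (r - k.*2) k (dti v))
  (fun k => psi (r - k.*2).-1 k (dtct v)) ec; rewrite /= -/a => e.
transitivity (step_factor c r * (al - 1) * be *
  (\sum_(k < r.+2) gcoef r.+1 k c *
     (a * psi (r.+1 - k.*2) k v + (r.+1%:R - k.*2%:R) * psi (r - k.*2) k (dti v)
     - 2 * k%:R * psi (r - (k.-1).*2).-1 k.-1 (dtct v)))); last first.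
  congr (_ * _); apply: eq_bigr => -[k /= _] _.
  have [h|h] := leqP k.*2 r.+1; last by rewrite (gcoef_out c h) !mul0r.
  congr (_ * (_ + _ * psi _ _ _ - _)); first by lia.
  case: k h => [|k h]; first by rewrite mulr0 !mul0r.
  by congr (_ * psi _ _ _); lia.
rewrite -{}e; apply: eq_bigr => -[k /= _] _.
have [h|h] := leqP k.*2 r; last by rewrite (gcoef_out c h) !mul0r.
congr (_ * _); rewrite psi_bs_op psi_dti_bs_op psi_dtct_bs_op.
have -> : (r.+1 - k.*2)%N = (r - k.*2).+1 by lia.
have -> : (r.+1 - k.+1.*2)%N = (r - k.*2).-1 by lia.
have -> : (r - k.+1.*2)%N = (r - k.*2).-1.-1 by lia.
have -> : r%:R - k.*2%:R = (r - k.*2)%:R :> K by rewrite natrB.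
have eH : k%:R * psi (r - (k.-1).*2).-1 k.-1 (dtct v) =
          k%:R * psi (r - k.*2).+1 k.-1 (dtct v).
  by case: k h => [|k h]; rewrite ?mul0r //; congr (_ * psi _ _ _); lia.
have eH2 u : k%:R * psi (r - k.*2) k.-1.+1 u = k%:R * psi (r - k.*2) k u.
  by case: k {h eH} => [|k]; rewrite ?mul0r.
have eH3 u : k%:R * psi (r - k.*2).-1 k.-1.+1 u = k%:R * psi (r - k.*2).-1 k u.
  by case: k {h eH eH2} => [|k]; rewrite ?mul0r.
move: eH eH2 eH3; move: (r - k.*2)%N => j eH eH2 eH3.
congr (_ + _ - _).
  by case: j {eH eH2 eH3} => [|j]; rewrite ?mul0r //= -!natr1; ring.
have distr p q s x y z : 2 * k%:R * (p * x + q * y + s * z) =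
    2 * (p * (k%:R * x) + q * (k%:R * y) + s * (k%:R * z)) :> K by ring.
by rewrite !distr eH eH2 eH3.
Qed.

(** The composition of [r] factors, the rightmost factor being peeled off first;
    lowering [lam] by one lowers both [al] and [be] by one. *)
Fixpoint bs_iter r al be v :=
  if r is r'.+1 then bs_iter r' (al - 1) (be - 1) (bs_op al be v) else v.

(** Order [r] with parameters lowered by one and order [r + 1] share the values
    of [a = al - r] and [c = al + be + 1 - 2 r], so [qsum_bs_op] applies directly. *)
Lemma phi_bs_iter r al be v : (0 < r)%N ->
  phi (bs_iter r al be v) =
  bs_const al be r * qsum r (al - r%:R) (al + be + 1 - 2 * r%:R) v.
Proof.
case: r => // r _; elim: r al be v => [|r IH] al be v.
  rewrite /= -[phi _]/(psi 0 0 _) psi_bs_op bs_const1 /qsum !big_ord_recl big_ord0 /=.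
  rewrite [gcoef 1 1 _]gcoef_out // mul0r !addr0.
  have := @gcoef_succ _ (al + be + 1 - 2 * 1) 0 0 isT => /=.
  rewrite [gcoef 0 0 _](gcoef_diag _ 0) subr0 !mul1r => ->.
  by rewrite /=; ring.
rewrite -[phi _]/(phi (bs_iter r.+1 (al - 1) (be - 1) (bs_op al be v))) IH.
rewrite [bs_const al be _]bs_constS //.
have := qsum_bs_op r.+1 al be v; rewrite /=.
have -> : al - 1 - r.+1%:R = al - r.+2%:R by rewrite -!natr1; ring.
have -> : al + be - 1 - 2 * r.+1%:R = al + be + 1 - 2 * r.+2%:R.
  by rewrite -!natr1; ring.
have -> : al - 1 + (be - 1) + 1 - 2 * r.+1%:R = al + be + 1 - 2 * r.+2%:R.
  by rewrite -!natr1; ring.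
by move=> ->; rewrite -!mulrA.
Qed.
End OperatorAlgebra.

(** * Symmetry of second derivatives *)

Local Open Scope classical_set_scope.

Section Schwarz.
Variables (R : realType) (U : normedModType R).
Implicit Types (f : U -> R) (x u v : U) (t h : R).

Lemma derivable_line f x v t : derivable f (t *: v + x) v ->
  is_derive t 1 (fun s => f (s *: v + x)) ('D_v f (t *: v + x)).
Proof.
have e : (fun h => h^-1 *: (f ((h *: (1 : R) + t) *: v + x) - f (t *: v + x))) =
         (fun h => h^-1 *: (f (h *: v + (t *: v + x)) - f (t *: v + x))).
  by apply/funext => h; rewrite [h *: 1]mulr1 scalerDl addrA.
by move=> df; split; rewrite /derivable /derive /= e.
Qed.

Lemma line_MVT f x v h : 0 < h -> (forall y, derivable f y v) ->
  exists2 t, 0 < t < h & f (h *: v + x) - f x = 'D_v f (t *: v + x) * h.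
Proof.
move=> h0 df.
have dg t := derivable_line (df (t *: v + x)).
have cg : {within `[0, h], continuous (fun s => f (s *: v + x))}.
  by apply: derivable_within_continuous => t _; apply: ex_derive.
have [t th] := MVT h0 (fun t _ => dg t) cg.
rewrite subr0 scale0r add0r => e; exists t => //.
Qed.

Lemma second_difference_MVT f x u v h : 0 < h ->
  (forall y, derivable f y u) -> (forall y, derivable ('D_u f) y v) ->
  exists t s, [/\ 0 < t < h, 0 < s < h &
    f (h *: u + (h *: v + x)) - f (h *: u + x) - (f (h *: v + x) - f x) =
    'D_v ('D_u f) (s *: v + (t *: u + x)) * h * h].
Proof.
move=> h0 dfu dfv.
pose g y := f (h *: v + y) - f y.
have dshift y : is_derive y u (fun y => f (h *: v + y)) ('D_u f (h *: v + y)).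
  have e : (fun k : R => k^-1 *: (f (h *: v + (k *: u + y)) - f (h *: v + y))) =
           (fun k => k^-1 *: (f (k *: u + (h *: v + y)) - f (h *: v + y))).
    by apply/funext => k; rewrite addrCA.
  by split; [have := dfu (h *: v + y)|]; rewrite /derivable /derive /= e.
have dg y : is_derive y u g ('D_u f (h *: v + y) - 'D_u f y).
  by apply: is_deriveB => //; apply: derivableP.
have [t th e1] := @line_MVT g x u h h0 (fun y => @ex_derive _ _ _ _ _ _ _ (dg y)).
have [s sh e2] := @line_MVT ('D_u f) (t *: u + x) v h h0 dfv.
exists t, s; split=> //.
have swap : h *: v + (h *: u + x) = h *: u + (h *: v + x) by rewrite addrCA.
move: e1; rewrite /g swap => ->.
by rewrite (@derive_val _ _ _ _ _ _ _ (dg _)) e2.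
Qed.

(** Apply the mean value theorem twice to the second difference over a small
    parallelogram, in both orders: the two mixed derivatives agree at points
    arbitrarily near [x], hence at [x] by continuity. *)
Lemma schwarz f x u v :
  (forall y, derivable f y u) -> (forall y, derivable f y v) ->
  (forall y, derivable ('D_u f) y v) -> (forall y, derivable ('D_v f) y u) ->
  {for x, continuous ('D_v ('D_u f))} -> {for x, continuous ('D_u ('D_v f))} ->
  'D_v ('D_u f) x = 'D_u ('D_v f) x.
Proof.
move=> dfu dfv dfuv dfvu cA cB; apply/eqP; rewrite -subr_eq0 -normr_le0.
apply/ler_addgt0Pr => e e0; rewrite add0r.
have e2 : 0 < e / 2 by rewrite divr_gt0.
have [d /= d0 dA] : exists2 d : R, 0 < d & forall y, `|x - y| < d ->
    `|'D_v ('D_u f) x - 'D_v ('D_u f) y| < e / 2 /\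
    `|'D_u ('D_v f) x - 'D_u ('D_v f) y| < e / 2.
  have nA : \forall y \near x, `|'D_v ('D_u f) x - 'D_v ('D_u f) y| < e / 2 /\
    `|'D_u ('D_v f) x - 'D_u ('D_v f) y| < e / 2.
    by apply: filterI; [move/cvgrPdist_lt: cA => /(_ _ e2)|move/cvgrPdist_lt: cB => /(_ _ e2)].
  by move/nbhs_ballP: nA => [d d0 H]; exists d => // y xy; apply: H; rewrite -ball_normE.
(* A step [h] for which the parallelogram with sides [h u], [h v] stays within [d] of [x]. *)
pose h := d / (`|u| + `|v| + 1).
have nuv : 0 < `|u| + `|v| + 1 by rewrite ltr_wpDl // addr_ge0.
have h0 : 0 < h by rewrite divr_gt0.
have small a b : 0 < a < h -> 0 < b < h -> `|x - (a *: v + (b *: u + x))| < d.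
  move=> /andP[a0 ah] /andP[b0 bh].
  rewrite addrA opprD addrCA subrr addr0 normrN.
  apply: (le_lt_trans (ler_normD _ _)); rewrite !normrZ !gtr0_norm //.
  have hd : h * (`|u| + `|v| + 1) = d by rewrite divfK // gt_eqF.
  have ha : a * `|v| <= h * `|v| by rewrite ler_wpM2r // ltW.
  have hb : b * `|u| <= h * `|u| by rewrite ler_wpM2r // ltW.
  lra.
have [t [s [th sh e1]]] := @second_difference_MVT f x u v h h0 dfu dfuv.
have [t' [s' [th' sh' e1']]] := @second_difference_MVT f x v u h h0 dfv dfvu.
have eq : 'D_v ('D_u f) (s *: v + (t *: u + x)) = 'D_u ('D_v f) (s' *: u + (t' *: v + x)).
  have hn : h != 0 by rewrite gt_eqF.
  have cancel (X Y P Q : R) : P = X * h * h -> Q = Y * h * h -> P = Q -> X = Y.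
    by move=> -> -> /(mulIf hn)/(mulIf hn).
  apply: (cancel _ _ _ _ e1 e1'); rewrite addrCA.
  by move: (f (_ + (_ + _))) (f (h *: u + x)) (f (h *: v + x)) (f x) => a b p q; ring.
have [A1 _] := dA _ (small _ _ sh th).
have := small _ _ th' sh'; rewrite addrCA => /dA[_ B1].
move: A1 B1; rewrite eq => A1 B1.
move: A1 B1; move: ('D_u ('D_v f) (s' *: _ + _)) => p.
move: ('D_v ('D_u f) x) ('D_u ('D_v f) x) => A B A1 B1.
have -> : A - B = (A - p) - (B - p) by ring.
rewrite (splitr e); apply: le_trans (ler_normB _ _) _.
exact: lerD (ltW A1) (ltW B1).
Qed.
End Schwarz.

(** * Smooth functions *)

Section CkTheory.
Variables (R : realType) (n : nat).
Local Notation T := 'rV[R]_n.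
Local Notation e_ := (@basis_vec R n).
Implicit Types (f g : T -> R) (k l : 'I_n) (r : nat).

Lemma CkW r f : Ck r.+1 f -> Ck r f.
Proof.
elim: r f => [|r IH] f; first by case.
by move=> [cf df Df]; split=> // k; apply: IH.
Qed.

Lemma CkD r f g : Ck r f -> Ck r g -> Ck r (fun x => f x + g x).
Proof.
elim: r f g => [|r IH] f g.
  by move=> cf cg x; apply: continuousD; [exact: cf|exact: cg].
move=> [cf df Df] [cg dg Dg]; split.
- by move=> x; apply: continuousD; [exact: cf|exact: cg].
- by move=> k x; apply: derivableD.
- move=> k; rewrite (_ : (fun x => _) = fun x => 'D_(e_ k) f x + 'D_(e_ k) g x).
    by apply: IH; [exact: Df|exact: Dg].
  by apply/funext => x; apply: deriveD.
Qed.

Lemma CkZ r (a : R) f : Ck r f -> Ck r (fun x => a * f x).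
Proof.
elim: r f => [|r IH] f.
  by move=> cf x; apply: continuousM; [exact: cst_continuous|exact: cf].
move=> [cf df Df]; split.
- by move=> x; apply: continuousM; [exact: cst_continuous|exact: cf].
- by move=> k x; apply: derivableZ.
- move=> k; rewrite (_ : (fun x => _) = fun x => a * 'D_(e_ k) f x).
    by apply: IH; exact: Df.
  by apply/funext => x; apply: deriveZ.
Qed.

Lemma Ck_cst r (a : R) : Ck r (fun _ : T => a).
Proof.
elim: r a => [|r IH] a; first by move=> x; apply: cst_continuous.
split=> [x|k x|k]; first by apply: cst_continuous.
  exact: derivable_cst.
rewrite (_ : (fun x => _) = fun _ : T => 0 : R); first exact: (IH 0).
by apply/funext => x; apply: derive_cst.
Qed.

Lemma is_derive_coord k (x v : T) : is_derive x v (fun y : T => y ord0 k) (v ord0 k).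
Proof.
have e : (fun h : R => h^-1 *: ((h *: v + x) ord0 k - x ord0 k)) @ 0^' --> v ord0 k.
  apply: cvg_near_cst; near=> h.
  rewrite !mxE addrK; apply: (@mulKf _ h); near: h; exact: nbhs_dnbhs_neq.
split; first by apply/cvg_ex; exists (v ord0 k).
exact: cvg_lim e.
Unshelve. all: by end_near.
Qed.

Lemma Ck_coord r k f : Ck r f -> Ck r (fun x => x ord0 k * f x).
Proof.
have cc : continuous (fun x : T => x ord0 k) by exact: coord_continuous.
elim: r f => [|r IH] f.
  by move=> cf x; apply: continuousM; [exact: cc|exact: cf].
move=> /[dup] Cf [cf df Df]; split.
- by move=> x; apply: continuousM; [exact: cc|exact: cf].
- move=> l x; apply: derivableM => //.
  by have [] := is_derive_coord k x (e_ l).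
- move=> l; rewrite (_ : (fun x => _) =
    fun x => (e_ l) ord0 k * f x + x ord0 k * 'D_(e_ l) f x).
    by apply: CkD; [apply: CkZ; exact: CkW|apply: IH; exact: Df].
  apply/funext => x; have [dc ec] := is_derive_coord k x (e_ l).
  rewrite (deriveM dc (df l x)) ec addrC; congr (_ + _).
  exact: mulrC.
Qed.
End CkTheory.

Section SmoothTheory.
Variables (R : realType) (n : nat).
Local Notation T := 'rV[R]_n.
Local Notation e_ := (@basis_vec R n).
Implicit Types (f g : T -> R[i]) (k l : 'I_n).

Lemma ReD (z w : R[i]) : complex.Re (z + w) = complex.Re z + complex.Re w.
Proof. by case: z; case: w. Qed.

Lemma ImD (z w : R[i]) : complex.Im (z + w) = complex.Im z + complex.Im w.
Proof. by case: z; case: w. Qed.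

Lemma ReM (c z : R[i]) : complex.Re (c * z) =
  complex.Re c * complex.Re z + - complex.Im c * complex.Im z.
Proof. by case: c; case: z => * /=; rewrite mulNr. Qed.

Lemma ImM (c z : R[i]) : complex.Im (c * z) =
  complex.Re c * complex.Im z + complex.Im c * complex.Re z.
Proof. by case: c; case: z => *. Qed.

Lemma smoothD f g : smooth f -> smooth g -> smooth (fun x => f x + g x).
Proof.
move=> sf sg r; have [[f1 f2] [g1 g2]] := (sf r, sg r); split.
  under [X in Ck _ X]funext => x do rewrite ReD.
  exact: CkD.
under [X in Ck _ X]funext => x do rewrite ImD.
exact: CkD.
Qed.

Lemma smoothZ (c : R[i]) f : smooth f -> smooth (fun x => c * f x).
Proof.
move=> sf r; have [f1 f2] := sf r; split.
  under [X in Ck _ X]funext => x do rewrite ReM.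
  by apply: CkD; exact: CkZ.
under [X in Ck _ X]funext => x do rewrite ImM.
by apply: CkD; exact: CkZ.
Qed.

Lemma smooth_cst (c : R[i]) : smooth (fun _ : T => c).
Proof. by move=> r; split; exact: Ck_cst. Qed.

Lemma smooth_partial k f : smooth f -> smooth (partial k f).
Proof. by move=> sf r; have [[_ _ f1] [_ _ f2]] := sf r.+1; split; [exact: f1|exact: f2]. Qed.

Lemma smooth_coord k f : smooth f -> smooth (fun x => (x ord0 k)%:C * f x).
Proof.
move=> sf r; have [f1 f2] := sf r; split.
  under [X in Ck _ X]funext => x do rewrite ReM /= oppr0 mul0r addr0.
  exact: Ck_coord.
under [X in Ck _ X]funext => x do rewrite ImM /= mul0r addr0.
exact: Ck_coord.
Qed.

Lemma smooth_derivable_Re f k x : smooth f ->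
  derivable (fun y => complex.Re (f y)) x (e_ k).
Proof. by move=> /(_ 1%N) [[_ d _] _]; exact: d. Qed.

Lemma smooth_derivable_Im f k x : smooth f ->
  derivable (fun y => complex.Im (f y)) x (e_ k).
Proof. by move=> /(_ 1%N) [_ [_ d _]]; exact: d. Qed.

Lemma eq_complex_parts (z w : R[i]) :
  complex.Re z = complex.Re w -> complex.Im z = complex.Im w -> z = w.
Proof. by case: z; case: w => ? ? ? ? /= -> ->. Qed.

Lemma partialD k f g x : smooth f -> smooth g ->
  partial k (fun y => f y + g y) x = partial k f x + partial k g x.
Proof.
move=> sf sg; apply: eq_complex_parts; rewrite ?ReD ?ImD /=.
  under [X in derive X _ _ = _]funext => y do rewrite ReD.
  by apply: deriveD; exact: smooth_derivable_Re.
under [X in derive X _ _ = _]funext => y do rewrite ImD.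
by apply: deriveD; exact: smooth_derivable_Im.
Qed.

Lemma derive_lincomb (a b : R) (h1 h2 : T -> R) (x v : T) :
  derivable h1 x v -> derivable h2 x v ->
  'D_v (fun y => a * h1 y + b * h2 y) x = a * 'D_v h1 x + b * 'D_v h2 x.
Proof.
move=> d1 d2.
have D1 : is_derive x v (fun y => a * h1 y) (a * 'D_v h1 x).
  by apply: is_deriveZ; exact: derivableP.
have D2 : is_derive x v (fun y => b * h2 y) (b * 'D_v h2 x).
  by apply: is_deriveZ; exact: derivableP.
by have [] := is_deriveD D1 D2.
Qed.

Lemma partialZ k (c : R[i]) f x : smooth f ->
  partial k (fun y => c * f y) x = c * partial k f x.
Proof.
move=> sf; have dR := @smooth_derivable_Re f k x sf; have dI := @smooth_derivable_Im f k x sf.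
apply: eq_complex_parts; rewrite ?ReM ?ImM /=.
  under [X in derive X _ _ = _]funext => y do rewrite ReM.
  exact: derive_lincomb dR dI.
under [X in derive X _ _ = _]funext => y do rewrite ImM.
exact: derive_lincomb dI dR.
Qed.

Lemma partial_coord k l f x : smooth f ->
  partial k (fun y => (y ord0 l)%:C * f y) x =
  (k == l)%:R * f x + (x ord0 l)%:C * partial k f x.
Proof.
move=> sf; have dR := @smooth_derivable_Re f k x sf; have dI := @smooth_derivable_Im f k x sf.
have [dc ec] := is_derive_coord l x (e_ k).
have ekl : e_ k ord0 l = (k == l)%:R :> R by rewrite mxE eqxx eq_sym.
have -> : (k == l)%:R = ((k == l)%:R : R)%:C by case: eqP.
apply: eq_complex_parts; rewrite ?ReD ?ImD ?ReM ?ImM /= ?(oppr0, mul0r, addr0).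
  under [X in derive X _ _ = _]funext => y do rewrite ReM /= oppr0 mul0r addr0.
  by rewrite (deriveM dc dR) ec ekl addrC; congr (_ + _); exact: mulrC.
under [X in derive X _ _ = _]funext => y do rewrite ImM /= mul0r addr0.
by rewrite (deriveM dc dI) ec ekl addrC; congr (_ + _); exact: mulrC.
Qed.

Lemma partialC k l f x : smooth f -> partial k (partial l f) x = partial l (partial k f) x.
Proof.
move=> sf; have [[_ dR CR] [_ dI CI]] := sf 2%N.
apply: eq_complex_parts => /=; apply: schwarz => //.
- by have [_ d _] := CR l => y; exact: d.
- by have [_ d _] := CR k => y; exact: d.
- by have [_ _ c] := CR l; exact: c.
- by have [_ _ c] := CR k; exact: c.
- by have [_ d _] := CI l => y; exact: d.
- by have [_ d _] := CI k => y; exact: d.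
- by have [_ _ c] := CI l; exact: c.
- by have [_ _ c] := CI k; exact: c.
Qed.
End SmoothTheory.

(** * The module of smooth forms *)

Section SmoothForms.
Variables (R : realType) (n : nat).
Implicit Types (w : dform R n) (k l : 'I_n).

Definition smooth_form w : Prop := forall s, smooth (fun x => w x s).

Lemma smooth_form0 : smooth_form 0.
Proof. by move=> s; exact: smooth_cst. Qed.

Lemma smooth_form_lin (a : R[i]) u w : smooth_form u -> smooth_form w ->
  smooth_form (a *: u + w).
Proof. by move=> su sw s; apply: smoothD; [apply: smoothZ; exact: su|exact: sw]. Qed.

Lemma smooth_sum (I : Type) (r : seq I) (F : I -> 'rV[R]_n -> R[i]) :
  (forall i, smooth (F i)) -> smooth (fun x => \sum_(i <- r) F i x).
Proof.
move=> sF; elim: r => [|i r IH].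
  by under [X in smooth X]funext => x do rewrite big_nil; exact: smooth_cst.
under [X in smooth X]funext => x do rewrite big_cons.
exact: smoothD.
Qed.

Lemma smooth_fpartial k w : smooth_form w -> smooth_form (fpartial k w).
Proof. by move=> sw s; exact: smooth_partial. Qed.

Lemma smooth_int_prod k w : smooth_form w -> smooth_form (int_prod k w).
Proof. by move=> sw s; exact: sw. Qed.

Lemma smooth_ext_prod k w : smooth_form w -> smooth_form (ext_prod k w).
Proof. by move=> sw s; apply: smooth_sum => i; apply: smoothZ; exact: sw. Qed.

Lemma smooth_coord_mul k w : smooth_form w -> smooth_form (coord_mul k w).
Proof. by move=> sw s; exact: smooth_coord. Qed.

Definition smooth_form_pred : {pred dform R n} := fun w => `[< smooth_form w >].

Lemma smooth_form_predP w : reflect (smooth_form w) (w \in smooth_form_pred).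
Proof. exact: asboolP. Qed.

Lemma smooth_form_submod : submod_closed smooth_form_pred.
Proof.
split; first by apply/smooth_form_predP; exact: smooth_form0.
move=> a u v /smooth_form_predP su /smooth_form_predP sv.
by apply/smooth_form_predP; exact: smooth_form_lin.
Qed.

HB.instance Definition _ :=
  GRing.isSubmodClosed.Build R[i] (dform R n) smooth_form_pred smooth_form_submod.

(** Partial derivatives are additive only on differentiable functions; on this
    submodule all operators become genuine linear endomorphisms. *)
Record sform := SForm { sform_val : dform R n; _ : sform_val \in smooth_form_pred }.
HB.instance Definition _ := [isSub for sform_val].
HB.instance Definition _ := [Choice of sform by <:].
HB.instance Definition _ := [SubChoice_isSubLmodule of sform by <:].

Lemma sform_smooth (v : sform) : smooth_form (sform_val v).
Proof. by case: v => w /= /smooth_form_predP. Qed.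

Lemma sform_eq (u v : sform) : (forall x s, sform_val u x s = sform_val v x s) -> u = v.
Proof. by move=> uv; apply: val_inj; apply/funext => x; apply/funext => s; exact: uv. Qed.

Definition lift_op (F : dform R n -> dform R n)
  (Fs : forall w, smooth_form w -> smooth_form (F w)) (v : sform) : sform :=
  SForm (introT (smooth_form_predP _) (Fs _ (sform_smooth v))).

Definition s_partial k := lift_op (@smooth_fpartial k).
Definition s_int k := lift_op (@smooth_int_prod k).
Definition s_ext k := lift_op (@smooth_ext_prod k).
Definition s_coord k := lift_op (@smooth_coord_mul k).

Lemma s_partial_linear k : linear (s_partial k).
Proof.
move=> a u v; apply: sform_eq => x s.
have su := sform_smooth u; have sv := sform_smooth v.
rewrite /= /fpartial (partialD _ _ (smoothZ a (su s)) (sv s)) partialZ //.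
Qed.
HB.instance Definition _ k := GRing.isLinear.Build _ _ _ _ (s_partial k) (s_partial_linear k).

Lemma s_int_linear k : linear (s_int k).
Proof. by move=> a u v; apply: sform_eq. Qed.
HB.instance Definition _ k := GRing.isLinear.Build _ _ _ _ (s_int k) (s_int_linear k).

Lemma s_ext_linear k : linear (s_ext k).
Proof.
move=> a u v; apply: sform_eq => x s.
have e y : sform_val (a *: u + v) x y = a * sform_val u x y + sform_val v x y by [].
transitivity (a * ext_prod k (sform_val u) x s + ext_prod k (sform_val v) x s); last by [].
rewrite -[LHS]/(ext_prod k (sform_val (a *: u + v)) x s).
rewrite /ext_prod mulr_sumr -big_split; apply: eq_bigr => i _.
by rewrite e mulrDr /= [X in X + _]mulrCA.
Qed.
HB.instance Definition _ k := GRing.isLinear.Build _ _ _ _ (s_ext k) (s_ext_linear k).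

Lemma s_coord_linear k : linear (s_coord k).
Proof.
move=> a u v; apply: sform_eq => x s /=.
rewrite -[LHS]/((x ord0 k)%:C * (a * sform_val u x s + sform_val v x s)) mulrDr mulrCA.
by [].
Qed.
HB.instance Definition _ k := GRing.isLinear.Build _ _ _ _ (s_coord k) (s_coord_linear k).

Lemma s_partialC k l v : s_partial k (s_partial l v) = s_partial l (s_partial k v).
Proof. by apply: sform_eq => x s; apply: partialC; exact: sform_smooth. Qed.

Lemma s_partial_int k l v : s_partial k (s_int l v) = s_int l (s_partial k v).
Proof. exact: sform_eq. Qed.

Lemma partial_sum (I : Type) (r : seq I) (F : I -> 'rV[R]_n -> R[i]) k x :
  (forall i, smooth (F i)) ->
  partial k (fun y => \sum_(i <- r) F i y) x = \sum_(i <- r) partial k (F i) x.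
Proof.
move=> sF; elim: r => [|i r IH].
  rewrite big_nil; under [X in partial _ X]funext => y do rewrite big_nil.
  by apply: eq_complex_parts; apply: derive_cst.
rewrite big_cons -IH; under [X in partial _ X _ = _]funext => y do rewrite big_cons.
by apply: partialD => //; exact: smooth_sum.
Qed.

Lemma s_partial_ext k l v : s_partial k (s_ext l v) = s_ext l (s_partial k v).
Proof.
apply: sform_eq => x s /=; rewrite /fpartial /ext_prod.
have sv := sform_smooth v.
rewrite partial_sum => [|i]; last by apply: smoothZ; exact: sv.
by apply: eq_bigr => i _; apply: partialZ; exact: sv.
Qed.

Lemma s_partial_coord k l v :
  s_partial k (s_coord l v) = (k == l)%:R *: v + s_coord l (s_partial k v).
Proof. by apply: sform_eq => x s; apply: partial_coord; exact: sform_smooth. Qed.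

Lemma s_int_coord k l v : s_int k (s_coord l v) = s_coord l (s_int k v).
Proof. exact: sform_eq. Qed.

Lemma s_ext_coord k l v : s_ext k (s_coord l v) = s_coord l (s_ext k v).
Proof.
apply: sform_eq => x s /=; rewrite /ext_prod /coord_mul mulr_sumr.
by apply: eq_bigr => i _; rewrite mulrCA.
Qed.

Lemma s_int_ext k l v : s_int k (s_ext l v) = (k == l)%:R *: v - s_ext l (s_int k v).
Proof.
apply: sform_eq => x s /=; rewrite /int_prod {1}/ext_prod big_ord_recl /=.
rewrite expr0 mul1r drop0.
transitivity ((k == l)%:R * sform_val v x s
  - ext_prod l (int_prod k (sform_val v)) x s); last by [].
congr (_ + _); first by rewrite mxE eqxx [l == k]eq_sym; case: (k == l).
rewrite /ext_prod /int_prod -sumrN; apply: eq_bigr => i _.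
by rewrite exprS mulN1r !mulNr.
Qed.

(** Expansion along the first vector, which replaces alternating sums over
    positions by induction on the list of vectors. *)
Lemma ext_prod_cons k w x u s : ext_prod k w x (u :: s) =
  (u ord0 k)%:C * w x s - ext_prod k (fun y t => w y (u :: t)) x s.
Proof.
rewrite {1}/ext_prod big_ord_recl /= expr0 mul1r drop0; congr (_ + _).
by rewrite /ext_prod -sumrN; apply: eq_bigr => i _; rewrite exprS mulN1r !mulNr.
Qed.

(** Expanding both products along the first vector [u] leaves
    [u_k eps_l w - u_l eps_k w], antisymmetric in [k] and [l], and a double
    product on the shorter list. *)
Lemma ext_prod_anticomm k l w x s :
  ext_prod k (ext_prod l w) x s = - ext_prod l (ext_prod k w) x s.
Proof.
elim: s w => [|u s IH] w; first by rewrite /ext_prod !big_ord0 oppr0.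
have sub i j : ext_prod i (fun y t => ext_prod j w y (u :: t)) x s =
    (u ord0 j)%:C * ext_prod i w x s
    - ext_prod i (ext_prod j (fun y t => w y (u :: t))) x s.
  rewrite [LHS]/ext_prod [ext_prod i w x s]/ext_prod [ext_prod i (ext_prod j _) x s]/ext_prod.
  rewrite mulr_sumr -sumrB; apply: eq_bigr => a _.
  by rewrite ext_prod_cons mulrBr; congr (_ - _); rewrite mulrCA.
rewrite !ext_prod_cons !sub IH; ring.
Qed.

Lemma s_ext_anticomm k l v : s_ext k (s_ext l v) = - s_ext l (s_ext k v).
Proof. by apply: sform_eq => x s; apply: ext_prod_anticomm. Qed.

End SmoothForms.

(** * Relations between the tangential operators *)

Section Tangential.
Variables (R : realType) (m : nat).
Local Notation n := m.+1.
Local Notation V := (sform R n).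
Implicit Types (v : V) (k l : 'I_m).
Local Notation t_ k := (lift ord_max k).
Local Notation pd := (@s_partial R n).
Local Notation ip := (@s_int R n).
Local Notation ep := (@s_ext R n).
Local Notation dn := (pd ord_max).
Local Notation in_ := (ip ord_max).
Local Notation en := (ep ord_max).
Local Notation xn := (@s_coord R n ord_max).

Definition s_dt v : V := \sum_(k < m) ep (t_ k) (pd (t_ k) v).
Definition s_ct v : V := - \sum_(k < m) ip (t_ k) (pd (t_ k) v).

Lemma s_dt_linear : linear s_dt.
Proof.
by move=> a u v; rewrite /s_dt scaler_sumr -big_split; apply: eq_bigr => k _; rewrite !linearP.
Qed.
HB.instance Definition _ := GRing.isLinear.Build _ _ _ _ s_dt s_dt_linear.

Lemma s_ct_linear : linear s_ct.
Proof.
move=> a u v; rewrite /s_ct scalerN -opprD scaler_sumr -big_split; congr (- _).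
by apply: eq_bigr => k _; rewrite !linearP.
Qed.
HB.instance Definition _ := GRing.isLinear.Build _ _ _ _ s_ct s_ct_linear.

Lemma lift_max_neq k : (t_ k == ord_max) = false.
Proof. by apply/negbTE; rewrite eq_sym neq_lift. Qed.

Lemma dn_dt v : dn (s_dt v) = s_dt (dn v).
Proof.
by rewrite /s_dt linear_sum; apply: eq_bigr => k _ /=; rewrite s_partial_ext s_partialC.
Qed.

Lemma dn_ct v : dn (s_ct v) = s_ct (dn v).
Proof.
rewrite /s_ct linearN linear_sum; congr (- _).
by apply: eq_bigr => k _ /=; rewrite s_partial_int s_partialC.
Qed.

Lemma dn_xn v : dn (xn v) = v + xn (dn v).
Proof. by rewrite s_partial_coord eqxx scale1r. Qed.

Lemma dt_xn v : s_dt (xn v) = xn (s_dt v).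
Proof.
rewrite /s_dt linear_sum; apply: eq_bigr => k _ /=.
by rewrite s_partial_coord lift_max_neq scale0r add0r s_ext_coord.
Qed.

Lemma ct_xn v : s_ct (xn v) = xn (s_ct v).
Proof.
rewrite /s_ct (linearN xn) (linear_sum xn); congr (- _); apply: eq_bigr => k _ /=.
by rewrite s_partial_coord lift_max_neq scale0r add0r s_int_coord.
Qed.

Lemma in_en v : in_ (en v) = v - en (in_ v).
Proof. by rewrite s_int_ext eqxx scale1r. Qed.

Lemma dt_en v : s_dt (en v) = - en (s_dt v).
Proof.
rewrite /s_dt linear_sum -sumrN; apply: eq_bigr => k _ /=.
by rewrite s_partial_ext s_ext_anticomm.
Qed.

Lemma ct_en v : s_ct (en v) = - en (s_ct v).
Proof.
rewrite /s_ct (linearN en) (linear_sum en); congr (- _); rewrite -sumrN; apply: eq_bigr => k _ /=.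
by rewrite s_partial_ext s_int_ext lift_max_neq scale0r add0r.
Qed.

Lemma in_dt v : in_ (s_dt v) = - s_dt (in_ v).
Proof.
rewrite /s_dt linear_sum -sumrN; apply: eq_bigr => k _ /=.
by rewrite s_int_ext [ord_max == _]eq_sym lift_max_neq scale0r add0r s_partial_int.
Qed.

(** Antisymmetric exterior products against symmetric second derivatives. *)
Lemma dt_dt v : s_dt (s_dt v) = 0.
Proof.
have e : s_dt (s_dt v) = \sum_(k < m) \sum_(l < m) ep (t_ k) (ep (t_ l) (pd (t_ k) (pd (t_ l) v))).
  apply: eq_bigr => k _; rewrite /s_dt !linear_sum; apply: eq_bigr => l _ /=.
  by rewrite s_partial_ext.
have e2 : s_dt (s_dt v) = - s_dt (s_dt v).
  rewrite e [in RHS]exchange_big -sumrN /=.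
  apply: eq_bigr => k _; rewrite -sumrN; apply: eq_bigr => l _ /=.
  by rewrite s_ext_anticomm s_partialC.
have : 2%:R *: s_dt (s_dt v) = 0 by rewrite scaler_nat mulr2n {2}e2 subrr.
by move/eqP; rewrite scaler_eq0 pnatr_eq0 /= => /eqP.
Qed.

Definition s_lap v : V := \sum_(k < m) pd (t_ k) (pd (t_ k) v).

(** The tangential [d' delta' + delta' d'] is minus the Laplacian since
    [eps_l i_k + i_k eps_l] is the Kronecker symbol. *)
Lemma s_lapE v : - (s_dt (s_ct v) + s_ct (s_dt v)) = s_lap v.
Proof.
have e1 : s_dt (s_ct v) = - \sum_(k < m) \sum_(l < m)
    ep (t_ k) (ip (t_ l) (pd (t_ k) (pd (t_ l) v))).
  rewrite -sumrN; apply: eq_bigr => k _; rewrite /s_ct (linearN (pd _)) (linearN (ep _)).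
  congr (- _); rewrite (linear_sum (pd _)) (linear_sum (ep _)).
  by apply: eq_bigr => l _ /=; rewrite s_partial_int.
have e2 : s_ct (s_dt v) = - \sum_(k < m) \sum_(l < m)
    ((t_ k == t_ l)%:R *: pd (t_ l) (pd (t_ k) v)
     - ep (t_ l) (ip (t_ k) (pd (t_ l) (pd (t_ k) v)))).
  congr (- _); apply: eq_bigr => k _; rewrite /s_dt !linear_sum; apply: eq_bigr => l _ /=.
  by rewrite s_partial_ext s_int_ext s_partialC.
rewrite e1 e2 -opprD opprK [X in _ + X]exchange_big /= -big_split; apply: eq_bigr => k _ /=.
rewrite -big_split (bigD1 k) //= [X in _ + X]big1 => [|l lk].
  by rewrite eqxx scale1r addr0 addrCA subrr addr0.
by rewrite (inj_eq lift_inj) (negbTE lk) scale0r add0r addrN.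
Qed.

Lemma lap_ct v : s_lap (s_ct v) = s_ct (s_lap v).
Proof.
have pd_ct k u : pd (t_ k) (s_ct u) = s_ct (pd (t_ k) u).
  rewrite /s_ct (linearN (pd _)) (linear_sum (pd _)); congr (- _).
  by apply: eq_bigr => l _ /=; rewrite s_partial_int s_partialC.
by rewrite /s_lap (linear_sum s_ct); apply: eq_bigr => k _ /=; rewrite !pd_ct.
Qed.

Lemma lap_in v : s_lap (in_ v) = in_ (s_lap v).
Proof.
by rewrite /s_lap linear_sum; apply: eq_bigr => k _ /=; rewrite !s_partial_int.
Qed.
End Tangential.

(** * Pull-back and the families of the theorem *)

Section ScalarFamilies.
Variables (K : numFieldType) (V : lmodType K).
Variables (dn dt ct in_ : {linear V -> V}) (phi : V -> K).
Local Notation ps := (@psi K V dn dt ct phi).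
Local Notation qs := (@qsum K V dn dt ct in_ phi).

Definition fsum (r : nat) (c : K) v := \sum_(k < (r./2).+1) gcoef r k c * ps (r - k.*2) k v.

Lemma fsum_widen M r c v : (r./2 < M)%N ->
  fsum r c v = \sum_(k < M) gcoef r k c * ps (r - k.*2) k v.
Proof.
move=> h; rewrite /fsum (big_ord_widen M (fun k => gcoef r k c * ps (r - k.*2) k v) h).
rewrite big_mkcond; apply: eq_bigr => k _; case: ifP => // hk.
by rewrite gcoef_out ?mul0r //; lia.
Qed.

(** The three terms are scalar families again: [(r - 2k) e_k] is a multiple of a
    coefficient of order [r - 1] by [gcoef_succ], and [(k + 1) e_(k+1)] one of
    order [r - 2] by [gcoef_shift]. *)
Lemma qsum_fsum r a c v : (0 < r)%N ->
  qs r a c v = a * fsum r c v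
    + (if odd r then 1 else r%:R * (2 - c - r%:R)) * fsum (r - 1) c (dti dt in_ v)
    - (r./2).*2%:R * fsum (r - 2) (c + 2) (dtct dt ct v).
Proof.
move=> r0; rewrite !(@fsum_widen r.+1); [|lia..].
rewrite /qsum.
transitivity (\sum_(k < r.+1) (a * (gcoef r k c * ps (r - k.*2) k v)
   + (r%:R - k.*2%:R) * gcoef r k c * ps (r - k.*2).-1 k (dti dt in_ v)
   - 2 * (k%:R * gcoef r k c * ps (r - k.*2) k.-1 (dtct dt ct v)))).
  by apply: eq_bigr => k _; ring.
rewrite !big_split /= sumrN -!mulr_sumr; congr (_ + _ - _).
  rewrite mulr_sumr; apply: eq_bigr => -[k /= _] _.
  rewrite mulrA; have -> : (r - 1 - k.*2)%N = (r - k.*2).-1 by lia.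
  congr (_ * _).
  have [h|h] := leqP k.*2 (r - 1); last first.
    rewrite (gcoef_out _ h) mulr0.
    have [h2|h2] := leqP k.*2 r; last by rewrite (gcoef_out _ h2) mulr0.
    have e2 : r = k.*2 by lia.
    by rewrite [in LHS]e2 subrr mul0r.
  have := gcoef_succ c h; have -> : (r - 1).+1 = r by lia.
  move=> ->; congr (_ * _); have -> : odd (r - 1) = ~~ odd r by lia.
  case: (odd r) => //=; congr (_ * _).
  by rewrite natrB //; ring.
(* The summand [k = 0] vanishes on the left, which allows to shift [k] by one. *)
rewrite big_ord_recl /= !mul0r add0r [in RHS]big_ord_recr /=.
have -> : gcoef (r - 2) r (c + 2) = 0 by rewrite gcoef_out //; lia.
rewrite mul0r addr0 -muln2 natrM [_ * 2]mulrC -mulrA; congr (_ * _).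
rewrite mulr_sumr; apply: eq_bigr => -[k /= _] _.
rewrite /bump /= add1n mulrA.
have [h|h] := leqP k.+1.*2 r; last first.
  rewrite (gcoef_out _ h) mulr0 mul0r.
  have [h2|h2] := leqP k.*2 (r - 2); last by rewrite (gcoef_out _ h2) mulr0 mul0r.
  have e2 : r = 1%N by lia.
  by rewrite e2 !mul0r.
rewrite gcoef_shift //; congr (_ * ps _ _ _); lia.
Qed.
End ScalarFamilies.

Section PullbackFamilies.
Variables (R : realType) (m : nat).
Local Notation n := m.+1.
Local Notation V := (sform R n).
Implicit Types (v : V) (l : R[i]).
Local Notation dn := (@s_partial R n ord_max).
Local Notation in_ := (@s_int R n ord_max).
Local Notation en := (@s_ext R n ord_max).
Local Notation xn := (@s_coord R n ord_max).
Local Notation dt := (@s_dt R m).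
Local Notation ct := (@s_ct R m).
Local Notation val_ := (@sform_val R n).

Lemma sform_valD u v : val_ (u + v) = val_ u + val_ v. Proof. by []. Qed.
Lemma sform_valN v : val_ (- v) = - val_ v. Proof. by []. Qed.
Lemma sform_valZ (a : R[i]) v : val_ (a *: v) = a *: val_ v. Proof. by []. Qed.

Lemma sform_val_sum (I : Type) (r : seq I) (F : I -> V) :
  val_ (\sum_(i <- r) F i) = \sum_(i <- r) val_ (F i).
Proof. exact: (big_morph val_ (fun _ _ => erefl) erefl). Qed.

Lemma sform_val_dt v : val_ (dt v) = tan_d (val_ v).
Proof. exact: sform_val_sum. Qed.

Lemma sform_val_ct v : val_ (ct v) = tan_codiff (val_ v).
Proof. by rewrite -[LHS]/(- val_ (\sum_k _)) sform_val_sum. Qed.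

Lemma big_ord_lift_max (W : nmodType) (F : 'I_n -> W) :
  \sum_(k < n) F k = \sum_(k < m) F (lift ord_max k) + F ord_max.
Proof.
rewrite big_ord_recr; congr (_ + _); apply: eq_bigr => k _.
by congr F; apply: val_inj; rewrite /= /bump leqNgt ltn_ord.
Qed.

Lemma sform_val_dtot v : val_ (dtot dn dt en v) = ext_d (val_ v).
Proof.
by rewrite /ext_d big_ord_lift_max /dtot sform_valD sform_val_dt.
Qed.

Lemma sform_val_ctot v : val_ (ctot dn ct in_ v) = codiff (val_ v).
Proof.
by rewrite /codiff big_ord_lift_max opprD /ctot sform_valD sform_val_ct sform_valN.
Qed.

Lemma sform_val_comb (c1 g a b c3 c4 : R[i]) (u1 u2 u3 u4 u5 : V) :
  val_ (- c1 *: u1 - g *: (a *: u2 + b *: u3) - c3 *: u4 - c4 *: u5) =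
  - c1 *: val_ u1 - g *: (a *: val_ u2 + b *: val_ u3) - c3 *: val_ u4 - c4 *: val_ u5.
Proof. by rewrite !(sform_valD, sform_valN, sform_valZ). Qed.

Lemma sform_val_bs_op p l v :
  val_ (bs_op dn xn dt ct in_ en (l - n%:R + p%:R) (l - p%:R) v) = P_op p l (val_ v).
Proof.
have e : 2 * l - n%:R - 2 = l - n%:R + p%:R + (l - p%:R) - 2 :> R[i] by ring.
pose dt' := dtot dn dt en; pose ct' := ctot dn ct in_.
have edt u : val_ (dt' u) = ext_d (val_ u) := sform_val_dtot u.
have ect u : val_ (ct' u) = codiff (val_ u) := sform_val_ctot u.
have een u : val_ (en u) = ext_prod ord_max (val_ u) by [].
have exn u : val_ (xn u) = coord_mul ord_max (val_ u) by [].
have ein u : val_ (in_ u) = int_prod ord_max (val_ u) by [].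
have edn u : val_ (dn u) = fpartial ord_max (val_ u) by [].
rewrite /P_op e -edn -ein -!ect -!edt -!ect -een -!exn.
exact: sform_val_comb.
Qed.

Lemma P_comp_bs_iter r p l v :
  P_comp r p l (val_ v) =
  val_ (bs_iter dn xn dt ct in_ en r (l - n%:R + p%:R) (l - p%:R) v).
Proof.
have shift q a w : P_comp q.+1 p a w = P_comp q p (a - 1) (P_op p a w).
  elim: q w => [|q IH] w; first by rewrite /= subr0.
  rewrite -[LHS]/(P_op p (a - q.+1%:R) (P_comp q.+1 p a w)) IH /=.
  by rewrite -natr1 opprD addrA addrAC.
elim: r l v => [|r IH] l v //.
rewrite shift -sform_val_bs_op IH /=.
by congr (val_ (bs_iter _ _ _ _ _ _ _ _ _ _)); ring.
Qed.

Lemma dform_sumE (q : nat) (I : Type) (r : seq I) (F : I -> dform R q) x t :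
  (\sum_(i <- r) F i) x t = \sum_(i <- r) F i x t.
Proof. by elim: r => [|i r IH]; rewrite ?big_nil // !big_cons -IH. Qed.

(** The hyperplane inclusion maps a line in the direction [e_k] to a line in the
    same direction, so the two difference quotients coincide. *)
Lemma partial_pullback (k : 'I_m) (f : 'rV[R]_n -> R[i]) (y : 'rV[R]_m) :
  partial k (fun z => f (iota_hyp z)) y = partial (lift ord_max k) f (iota_hyp y).
Proof.
have line (h : R) : iota_hyp (h *: basis_vec R k + y) =
    h *: basis_vec R (lift ord_max k) + iota_hyp y.
  apply/rowP => j; rewrite !mxE; case: unliftP => [i|] -> /=.
    by rewrite !mxE (inj_eq lift_inj).
  by rewrite eq_liftF mulr0 addr0.
have der (g : 'rV[R]_n -> R) : 'D_(basis_vec R k) (fun z => g (iota_hyp z)) y =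
    'D_(basis_vec R (lift ord_max k)) g (iota_hyp y).
  have e : (fun h : R => h^-1 *: (g (iota_hyp (h *: basis_vec R k + y)) - g (iota_hyp y))) =
      (fun h => h^-1 *: (g (h *: basis_vec R (lift ord_max k) + iota_hyp y) - g (iota_hyp y))).
    by apply/funext => h; rewrite line.
  by rewrite /derive /= e.
by rewrite /partial (der (fun x => complex.Re (f x))) (der (fun x => complex.Im (f x))).
Qed.

Lemma laplacian_pullback v : laplacian (pullback (val_ v)) = pullback (val_ (s_lap v)).
Proof.
rewrite sform_val_sum; apply/funext => y; apply/funext => s.
rewrite /laplacian dform_sumE [RHS]/pullback dform_sumE; apply: eq_bigr => k _.
rewrite -[RHS]/(partial _ (partial _ (fun x => val_ v x _)) _).
rewrite -partial_pullback; congr (partial k _ y); apply/funext => z.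
by rewrite -partial_pullback.
Qed.

Section Point.
Variables (y : 'rV[R]_m) (s : seq 'rV[R]_m).
Definition eval_pullback v : R[i] := pullback (val_ v) y s.

Lemma eval_pullback_xn v : eval_pullback (xn v) = 0.
Proof.
by rewrite /eval_pullback /pullback /= /coord_mul !mxE unlift_none /= mul0r.
Qed.

Lemma eval_pullback_en v : eval_pullback (en v) = 0.
Proof.
rewrite /eval_pullback /pullback /= /ext_prod big1 // => -[i /=]; rewrite size_map => hi _.
by rewrite (nth_map 0) // !mxE unlift_none /= mulr0 mul0r.
Qed.

Local Notation ps := (psi dn dt ct eval_pullback).

Lemma iter_laplacian_psi j k v :
  iter k (@laplacian R m) (pullback (iter j (fpartial ord_max) (val_ v))) y s = ps j k v.
Proof.
have -> : iter j (fpartial ord_max) (val_ v) = val_ (iter j dn v).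
  by elim: j => // j; rewrite !iterS => ->.
have -> u : iter k (@laplacian R m) (pullback (val_ u)) = pullback (val_ (iter k (@s_lap R m) u)).
  by elim: k => // k; rewrite !iterS => ->; rewrite laplacian_pullback.
rewrite /psi /eval_pullback; congr (pullback (val_ _) y s).
have -> : iter k (lap dt ct) v = iter k (@s_lap R m) v.
  by elim: k => // k; rewrite !iterS => ->; exact: s_lapE.
have dn_lap u : dn (s_lap u) = s_lap (dn u).
  rewrite /s_lap linear_sum; apply: eq_bigr => i _ /=.
  by rewrite s_partialC; congr (s_partial _ _); rewrite s_partialC.
have itd u : s_lap (iter j dn u) = iter j dn (s_lap u).
  by elim: j => // j IH; rewrite !iterS -dn_lap IH.
by elim: k => // k IH; rewrite !iterS IH itd.
Qed.

(** The argument is [c = 2 nu - 2 r + n + 1] at [nu = - l]. *)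
Lemma D_fam_fsum r l v : D_fam r l (val_ v) y s =
  fsum dn dt ct eval_pullback r (- (2 * l) - 2 * r%:R + n%:R + 1) v.
Proof.
rewrite /D_fam; have := odd_double_half r; case: ifP => ro /= hr.
  rewrite /D_odd dform_sumE /fsum; apply: eq_bigr => -[k /= hk] _.
  rewrite -[LHS]/(_ * iter k _ _ y s) iter_laplacian_psi.
  have -> : (2 * r./2 - 2 * k + 1)%N = (r - k.*2)%N by lia.
  congr (_ * _); rewrite /gcoef ifT; last by lia.
  rewrite /b_coef; have -> : (2 * r./2 - 2 * k + 1)%N = (r - k.*2)%N by lia.
  congr (_ * _); apply: eq_bigr => i _.
  by rewrite -[in r%:R]hr natrD -!muln2 !natrM; ring.
rewrite /D_even dform_sumE /fsum; apply: eq_bigr => -[k /= hk] _.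
rewrite -[LHS]/(_ * iter k _ _ y s) iter_laplacian_psi.
have -> : (2 * r./2 - 2 * k)%N = (r - k.*2)%N by lia.
congr (_ * _); rewrite /gcoef ifT; last by lia.
rewrite /a_coef; have -> : (2 * r./2 - 2 * k)%N = (r - k.*2)%N by lia.
congr (_ * _); apply: eq_bigr => i _.
by rewrite -[in r%:R]hr natrD -!muln2 !natrM; ring.
Qed.

Lemma D_BS_qsum r p l v : (0 < r)%N ->
  D_BS r p l (val_ v) y s =
  bs_const (l - n%:R + p%:R) (l - p%:R) r *
  qsum dn dt ct in_ eval_pullback r (p%:R - (n%:R - l) - r%:R)
    (- (2 * (n%:R - l)) - 2 * r%:R + n%:R + 1) v.
Proof.
move=> r0; rewrite /D_BS P_comp_bs_iter -[LHS]/(eval_pullback _).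
rewrite (@phi_bs_iter _ _ dn xn dt ct in_ en) //.
- by congr (_ * qsum _ _ _ _ _ _ _ _ _); ring.
- exact: dn_xn.
- exact: dn_dt.
- exact: dn_ct.
- by move=> u; exact: s_partial_int.
- by move=> u; exact: s_partial_ext.
- exact: dt_xn.
- exact: ct_xn.
- by move=> u; exact: s_int_coord.
- exact: in_en.
- exact: dt_en.
- exact: ct_en.
- exact: in_dt.
- exact: dt_dt.
- by move=> u; rewrite /lap !s_lapE lap_ct.
- by move=> u; rewrite /lap !s_lapE lap_in.
- exact: eval_pullback_xn.
- exact: eval_pullback_en.
Qed.

Lemma val_dti v : val_ (dti dt in_ v) = tan_d (int_prod ord_max (val_ v)).
Proof. by rewrite /dti sform_val_dt. Qed.

Lemma val_dtct v : val_ (dtct dt ct v) = tan_d (tan_codiff (val_ v)).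
Proof. by rewrite /dtct sform_val_dt sform_val_ct. Qed.

Lemma D_pp_even_qsum N p l v : (0 < N)%N ->
  D_pp_even N p l (val_ v) y s =
  qsum dn dt ct in_ eval_pullback (2 * N) (p%:R - l - (2 * N)%:R)
    (- (2 * l) - 2 * (2 * N)%:R + n%:R + 1) v.
Proof.
move=> N0; rewrite qsum_fsum; last by lia.
have -> : odd (2 * N) = false by lia.
have -> : (2 * N)./2.*2 = (2 * N)%N by lia.
rewrite /D_pp_even -val_dti -val_dtct.
transitivity ((p%:R - l - (2 * N)%:R) * D_fam (2 * N) l (val_ v) y s
  + (2 * N)%:R * (2 * l - n%:R + (2 * N)%:R + 1) *
      D_fam (2 * N - 1) (l + 1) (val_ (dti dt in_ v)) y s
  - (2 * N)%:R * D_fam (2 * N - 2) (l + 1) (val_ (dtct dt ct v)) y s); first by [].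
rewrite !D_fam_fsum; set c := - (2 * l) - _ + _ + _.
have -> : 2 * l - n%:R + (2 * N)%:R + 1 = 2 - c - (2 * N)%:R by rewrite /c; ring.
have -> : - (2 * (l + 1)) - 2 * (2 * N - 1)%:R + n%:R + 1 = c.
  by rewrite /c natrB; [ring|lia].
have -> : - (2 * (l + 1)) - 2 * (2 * N - 2)%:R + n%:R + 1 = c + 2.
  by rewrite /c natrB; [ring|lia].
by [].
Qed.

Lemma D_pp_odd_qsum N p l v :
  D_pp_odd N p l (val_ v) y s =
  qsum dn dt ct in_ eval_pullback (2 * N + 1) (p%:R - l - (2 * N + 1)%:R)
    (- (2 * l) - 2 * (2 * N + 1)%:R + n%:R + 1) v.
Proof.
rewrite qsum_fsum; last by lia.
have -> : odd (2 * N + 1) = true by lia.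
have -> : (2 * N + 1)./2.*2 = (2 * N)%N by lia.
rewrite /D_pp_odd -val_dti -val_dtct.
transitivity ((p%:R - l - (2 * N)%:R - 1) * D_fam (2 * N + 1) l (val_ v) y s
  + D_fam (2 * N) (l + 1) (val_ (dti dt in_ v)) y s
  - (2 * N)%:R * D_fam (2 * N - 1) (l + 1) (val_ (dtct dt ct v)) y s); first by [].
rewrite !D_fam_fsum mul1r; set c := - (2 * l) - _ + _ + _.
have -> : (2 * N + 1 - 1)%N = (2 * N)%N by lia.
have -> : p%:R - l - (2 * N)%:R - 1 = p%:R - l - (2 * N + 1)%:R by rewrite natrD; ring.
have -> : - (2 * (l + 1)) - 2 * (2 * N)%:R + n%:R + 1 = c by rewrite /c natrD; ring.
case: N @c => [|N] c; first by rewrite muln0 !mul0r.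
have -> : (2 * N.+1 + 1 - 2)%N = (2 * N.+1 - 1)%N by lia.
have -> : - (2 * (l + 1)) - 2 * (2 * N.+1 - 1)%:R + n%:R + 1 = c + 2.
  by rewrite /c natrB ?natrD; [ring|lia].
by [].
Qed.
End Point.
End PullbackFamilies.

Theorem theorem4p9 (R : realType) (m : nat) (N p : nat) (lam : R[i]) :
  let n : nat := m.+1 in
  (2 <= n)%N -> (p <= n)%N ->
  ((0 < N)%N -> forall w : dform R n, is_diff_form p w ->
    D_BS (2 * N) p lam w =
    ((- 2) ^+ N
     * pochhammer (lam - n%:R / 2 - (2 * N)%:R) N
     * (double_fact (2 * N - 1))%:R
     * pochhammer (lam - n%:R + p%:R - (2 * N)%:R + 1) (2 * N - 1)
     * pochhammer (lam - p%:R - (2 * N)%:R + 1) (2 * N))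
    *: D_pp_even N p (n%:R - lam) w)
  /\
  (forall w : dform R n, is_diff_form p w ->
    D_BS (2 * N + 1) p lam w =
    ((- 2) ^+ N.+1
     * pochhammer (lam - n%:R / 2 - (2 * N)%:R - 1) N.+1
     * (double_fact (2 * N + 1))%:R
     * pochhammer (lam - n%:R + p%:R - (2 * N)%:R) (2 * N)
     * pochhammer (lam - p%:R - (2 * N)%:R) (2 * N + 1))
    *: D_pp_odd N p (n%:R - lam) w).
Proof.
move=> n _ _; have half_sum : (lam - n%:R + p%:R + (lam - p%:R)) / 2 = lam - n%:R / 2.
  by field.
split=> [N0|] w [_ _ _ sw]; pose v := SForm (introT (smooth_form_predP w) sw);
  rewrite -[w]/(sform_val v); apply/funext => y; apply/funext => s.
  transitivity (bs_const (lam - n%:R + p%:R) (lam - p%:R) (2 * N) *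
    D_pp_even N p (n%:R - lam) (sform_val v) y s).
    by rewrite D_BS_qsum ?D_pp_even_qsum //; lia.
  rewrite -[RHS]/(_ * _); congr (_ * _); rewrite /bs_const half_sum.
  have -> : uphalf (2 * N) = N by lia.
  by rewrite -mul2n !subn1.
transitivity (bs_const (lam - n%:R + p%:R) (lam - p%:R) (2 * N + 1) *
  D_pp_odd N p (n%:R - lam) (sform_val v) y s).
  by rewrite D_BS_qsum ?D_pp_odd_qsum //; lia.
rewrite -[RHS]/(_ * _); congr (_ * _); rewrite /bs_const half_sum.
have -> : uphalf (2 * N + 1) = N.+1 by lia.
have -> : N.+1.*2.-1 = (2 * N + 1)%N by lia.
have -> : (2 * N + 1).-1 = (2 * N)%N by lia.
rewrite natrD; congr (_ * pochhammer _ _ * _ * pochhammer _ _ * pochhammer _ _); ring.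
Qed.
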